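(* Let $M$ be a countable transcendent structure in a recursive language $\mathcal L$, and let $\mathcal X$ be a Scott set witnessing transcendence of $M$. Let $T\in\mathcal X$ be a first-order theory and $p(\bar x)\in\mathcal X$ a type, both in a recursive extension $\mathcal L^+$ of $\mathcal L$, such that $T+p{\uparrow}$ is categorical over $M$. Suppose $\mathrm{Con}_{\mathrm{sat}}(T+p{\uparrow}/\mathrm{Th}(M))$ holds and let $N\models\mathrm{Th}(M)+T+p{\uparrow}$ have $\omega$-saturated $\mathcal L$-reduct. Then $M$ has a (unique) expansion $M^+\models T+p{\uparrow}$, and $M^+$ is elementarily embeddable into $N$ (as $\mathcal L^+$-structures); in particular any two such $N$ are elementarily equivalent.
   Context: A ''type'' $p(\bar x)$ is any set of first-order formulas with free variables among $\bar x$; $p{\uparrow}$ is $\forall\bar x\bigvee_{\psi\in p}\neg\psi(\bar x)$. A theory $S$ is categorical over a structure $M$ if at most one expansion of $M$ satisfies $S$. $\mathrm{Con}_{\mathrm{sat}}(S/T_0)$ ($T_0$ first-order in $\mathcal L$, $S$ in $\mathcal L^+$) means some model of $T_0+S$ has $\omega$-saturated $\mathcal L$-reduct. A Scott set is a nonempty $\mathcal X\subseteq\mathcal P(\omega)$ closed under finite unions, complements and Turing reducibility, such that every theory in $\mathcal X$ has a complete consistent extension in $\mathcal X$. $M$ is $\mathcal X$-saturated if a complete type $q(\bar x,\bar a)$ over $M$ (finitely many parameters) is realized iff $q(\bar x,\bar y)\in\mathcal X$. $M$ is transcendent, witnessed by $\mathcal X$, if $M$ is strongly homogeneous (tuples of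 equal type are automorphic), $\mathcal X$-saturated, and for every recursive extension $\mathcal L^+$, every first-order $\mathcal L^+$-theory $T\in\mathcal X$ and $\mathcal L^+$-type $p\in\mathcal X$ with $\mathrm{Con}_{\mathrm{sat}}(T+p{\uparrow}/\mathrm{Th}(M))$, some expansion of $M$ satisfies $T+p{\uparrow}$. *)

(* Defs.v *)
From Stdlib Require Import List Arith PeanoNat.
Import ListNotations.

Inductive prf : Type :=
| PZero | PSucc | PProj (i : nat) | POrc
| PComp (f : prf) (gs : list prf)
| PPrec (f g : prf)
| PMu (f : prf).

Inductive eval (A : nat -> Prop) : prf -> list nat -> nat -> Prop :=
| ev_zero : forall v, eval A PZero v 0
| ev_succ : forall x v, eval A PSucc (x :: v) (S x)
| ev_proj : forall i v, i < length v -> eval A (PProj i) v (nth i v 0)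
| ev_orc1 : forall x v, A x -> eval A POrc (x :: v) 1
| ev_orc0 : forall x v, ~ A x -> eval A POrc (x :: v) 0
| ev_comp : forall f gs v ys z,
    evals A gs v ys -> eval A f ys z -> eval A (PComp f gs) v z
| ev_prec0 : forall f g v y, eval A f v y -> eval A (PPrec f g) (0 :: v) y
| ev_precS : forall f g n v y z,
    eval A (PPrec f g) (n :: v) y -> eval A g (n :: y :: v) z ->
    eval A (PPrec f g) (S n :: v) z
| ev_mu : forall f v n,
    eval A f (n :: v) 0 ->
    (forall m, m < n -> exists k, eval A f (m :: v) (S k)) ->
    eval A (PMu f) v n
with evals (A : nat -> Prop) : list prf -> list nat -> list nat -> Prop :=
| evs_nil : forall v, evals A [] v []
| evs_cons : forall g gs v y ys,
    eval A g v y -> evals A gs v ys -> evals A (g :: gs) v (y :: ys).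

Definition Treducible (B A : nat -> Prop) : Prop :=
  exists e : prf, forall x,
    (B x -> eval A e [x] 1) /\ (~ B x -> eval A e [x] 0).

Definition recursive_set (B : nat -> Prop) : Prop :=
  Treducible B (fun _ => False).

Definition cpair (a b : nat) : nat := (a + b) * (a + b + 1) / 2 + b.

Definition ocode (o : option nat) : nat :=
  match o with None => 0 | Some n => S n end.

(* A language: function symbol i has arity n iff fun_ar i = Some n
   (None = not a symbol of the language); same for relation symbols.
   Equality is always present. *)
Record lang : Type := Lang {
  fun_ar : nat -> option nat;
  rel_ar : nat -> option nat }.

Definition graph_set (f : nat -> option nat) : nat -> Prop :=
  fun k => exists i, k = cpair i (ocode (f i)).

Definition recursive_lang (L : lang) : Prop :=
  recursive_set (graph_set (fun_ar L)) /\ recursive_set (graph_set (rel_ar L)).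

Definition lang_ext (L Lp : lang) : Prop :=
  (forall i n, fun_ar L i = Some n -> fun_ar Lp i = Some n) /\
  (forall i n, rel_ar L i = Some n -> rel_ar Lp i = Some n).

Definition recursive_ext (L Lp : lang) : Prop :=
  recursive_lang Lp /\ lang_ext L Lp.

Inductive term : Type :=
| tvar (n : nat)
| tapp (f : nat) (l : list term).

Inductive form : Type :=
| Feq (t1 t2 : term)
| Frel (r : nat) (l : list term)
| Fneg (phi : form)
| Fand (phi psi : form)
| Fex (x : nat) (phi : form).

Fixpoint wf_term (L : lang) (t : term) : Prop :=
  match t with
  | tvar _ => True
  | tapp f l => fun_ar L f = Some (length l) /\
                fold_right (fun u acc => wf_term L u /\ acc) True l
  end.

Definition wf_terms (L : lang) (l : list term) : Prop :=
  fold_right (fun u acc => wf_term L u /\ acc) True l.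

Fixpoint wf_form (L : lang) (phi : form) : Prop :=
  match phi with
  | Feq t1 t2 => wf_term L t1 /\ wf_term L t2
  | Frel r l => rel_ar L r = Some (length l) /\ wf_terms L l
  | Fneg a => wf_form L a
  | Fand a b => wf_form L a /\ wf_form L b
  | Fex _ a => wf_form L a
  end.

Fixpoint fv_term (t : term) : list nat :=
  match t with
  | tvar n => [n]
  | tapp _ l => flat_map fv_term l
  end.

Fixpoint fv (phi : form) : list nat :=
  match phi with
  | Feq t1 t2 => fv_term t1 ++ fv_term t2
  | Frel _ l => flat_map fv_term l
  | Fneg a => fv a
  | Fand a b => fv a ++ fv b
  | Fex x a => remove Nat.eq_dec x (fv a)
  end.

Definition sentence (L : lang) (phi : form) : Prop :=
  wf_form L phi /\ fv phi = [].

Fixpoint code_term (t : term) : nat :=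
  match t with
  | tvar n => cpair 0 n
  | tapp f l => cpair 1 (cpair f
                  (fold_right (fun u acc => S (cpair (code_term u) acc)) 0 l))
  end.

Definition code_terms (l : list term) : nat :=
  fold_right (fun u acc => S (cpair (code_term u) acc)) 0 l.

Fixpoint code (phi : form) : nat :=
  match phi with
  | Feq t1 t2 => cpair 0 (cpair (code_term t1) (code_term t2))
  | Frel r l => cpair 1 (cpair r (code_terms l))
  | Fneg a => cpair 2 (code a)
  | Fand a b => cpair 3 (cpair (code a) (code b))
  | Fex x a => cpair 4 (cpair x (code a))
  end.

Definition codeset (S : form -> Prop) : nat -> Prop :=
  fun k => exists phi, S phi /\ code phi = k.

(* A (nonempty) structure interpreting every symbol index; as an
   L-structure only the symbols of L (at their arities) matter. *)
Record str : Type := Str {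
  dom : Type;
  inh : dom;
  fn : nat -> list dom -> dom;
  rl : nat -> list dom -> Prop }.

Definition upd {D : Type} (s : nat -> D) (x : nat) (d : D) : nat -> D :=
  fun y => if Nat.eqb y x then d else s y.

Fixpoint teval (M : str) (s : nat -> dom M) (t : term) : dom M :=
  match t with
  | tvar n => s n
  | tapp f l => fn M f (map (teval M s) l)
  end.

Fixpoint sat (M : str) (s : nat -> dom M) (phi : form) : Prop :=
  match phi with
  | Feq t1 t2 => teval M s t1 = teval M s t2
  | Frel r l => rl M r (map (teval M s) l)
  | Fneg a => ~ sat M s a
  | Fand a b => sat M s a /\ sat M s b
  | Fex x a => exists d : dom M, sat M (upd s x d) a
  end.

Definition satS (M : str) (phi : form) : Prop := sat M (fun _ => inh M) phi.

Definition models_Th (L : lang) (M N : str) : Prop :=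
  forall phi, sentence L phi -> satS M phi -> satS N phi.

Definition models (N : str) (T : form -> Prop) : Prop :=
  forall phi, T phi -> satS N phi.

Definition theory (L : lang) (T : form -> Prop) : Prop :=
  forall phi, T phi -> sentence L phi.

Definition is_type (L : lang) (p : form -> Prop) : Prop :=
  exists xs : list nat, forall phi, p phi -> wf_form L phi /\ incl (fv phi) xs.

Definition omits (N : str) (p : form -> Prop) : Prop :=
  forall s : nat -> dom N, exists psi, p psi /\ ~ sat N s psi.

(* omega-saturation of the L-reduct of N: every set of L-formulas in one
   free variable x with finitely many parameters (variables in xs assigned
   by a) that is finitely satisfiable in N is realized in N. *)
Definition omega_sat (L : lang) (N : str) : Prop :=
  forall (xs : list nat) (a : nat -> dom N) (x : nat) (q : form -> Prop),
    (forall phi, q phi -> wf_form L phi /\ incl (fv phi) (x :: xs)) ->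
    (forall l : list form, (forall phi, In phi l -> q phi) ->
       exists b, forall phi, In phi l -> sat N (upd a x b) phi) ->
    exists b, forall phi, q phi -> sat N (upd a x b) phi.

Definition con_sat (L : lang) (M : str) (T p : form -> Prop) : Prop :=
  exists N : str, models_Th L M N /\ models N T /\ omits N p /\ omega_sat L N.

Definition expand (M : str) (f : nat -> list (dom M) -> dom M)
  (r : nat -> list (dom M) -> Prop) : str := Str (dom M) (inh M) f r.

Definition is_expansion (L : lang) (M : str) (f : nat -> list (dom M) -> dom M)
  (r : nat -> list (dom M) -> Prop) : Prop :=
  (forall i n, fun_ar L i = Some n ->
     forall l, length l = n -> f i l = fn M i l) /\
  (forall i n, rel_ar L i = Some n ->
     forall l, length l = n -> (r i l <-> rl M i l)).

Definition same_interp (Lp : lang) {D : Type}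
  (f1 f2 : nat -> list D -> D) (r1 r2 : nat -> list D -> Prop) : Prop :=
  (forall i n, fun_ar Lp i = Some n ->
     forall l, length l = n -> f1 i l = f2 i l) /\
  (forall i n, rel_ar Lp i = Some n ->
     forall l, length l = n -> (r1 i l <-> r2 i l)).

Definition categorical_over (L Lp : lang) (M : str) (T p : form -> Prop) : Prop :=
  forall f1 r1 f2 r2,
    is_expansion L M f1 r1 -> models (expand M f1 r1) T -> omits (expand M f1 r1) p ->
    is_expansion L M f2 r2 -> models (expand M f2 r2) T -> omits (expand M f2 r2) p ->
    same_interp Lp f1 f2 r1 r2.

Definition consistent (T : form -> Prop) : Prop := exists N : str, models N T.

Definition complete_th (L : lang) (T : form -> Prop) : Prop :=
  forall phi, sentence L phi -> T phi \/ T (Fneg phi).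

Definition scott_set (X : (nat -> Prop) -> Prop) : Prop :=
  (exists A, X A) /\
  (forall A B, X A -> X B -> X (fun n => A n \/ B n)) /\
  (forall A, X A -> X (fun n => ~ A n)) /\
  (forall A B, X A -> Treducible B A -> X B) /\
  (forall L T, recursive_lang L -> theory L T -> consistent T -> X (codeset T) ->
     exists T', (forall phi, T phi -> T' phi) /\ theory L T' /\
       complete_th L T' /\ consistent T' /\ X (codeset T')).

(* q(xs, ys) is a complete L-type over the parameters a|ys of M *)
Definition complete_type_over (L : lang) (M : str) (xs ys : list nat)
  (a : nat -> dom M) (q : form -> Prop) : Prop :=
  (forall phi, q phi -> wf_form L phi /\ incl (fv phi) (xs ++ ys)) /\
  (forall l : list form, (forall phi, In phi l -> q phi) ->
     exists s : nat -> dom M, (forall y, In y ys -> s y = a y) /\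
       forall phi, In phi l -> sat M s phi) /\
  (forall phi, wf_form L phi -> incl (fv phi) (xs ++ ys) -> q phi \/ q (Fneg phi)).

Definition realized (M : str) (ys : list nat) (a : nat -> dom M)
  (q : form -> Prop) : Prop :=
  exists s : nat -> dom M, (forall y, In y ys -> s y = a y) /\
    forall phi, q phi -> sat M s phi.

Definition X_saturated (L : lang) (X : (nat -> Prop) -> Prop) (M : str) : Prop :=
  forall (xs ys : list nat) (a : nat -> dom M) (q : form -> Prop),
    NoDup (xs ++ ys) ->
    complete_type_over L M xs ys a q ->
    (realized M ys a q <-> X (codeset q)).

Definition automorphism (L : lang) (M : str) (g : dom M -> dom M) : Prop :=
  (exists h : dom M -> dom M, (forall d, h (g d) = d) /\ (forall d, g (h d) = d)) /\
  (forall i n, fun_ar L i = Some n ->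
     forall l, length l = n -> g (fn M i l) = fn M i (map g l)) /\
  (forall i n, rel_ar L i = Some n ->
     forall l, length l = n -> (rl M i l <-> rl M i (map g l))).

Definition strongly_homogeneous (L : lang) (M : str) : Prop :=
  forall (n : nat) (a b : nat -> dom M),
    (forall phi, wf_form L phi -> incl (fv phi) (seq 0 n) ->
       (sat M a phi <-> sat M b phi)) ->
    exists g, automorphism L M g /\ forall i, i < n -> g (a i) = b i.

Definition transcendent_wit (L : lang) (M : str) (X : (nat -> Prop) -> Prop) : Prop :=
  strongly_homogeneous L M /\ X_saturated L X M /\
  forall (Lp : lang) (T p : form -> Prop),
    recursive_ext L Lp -> theory Lp T -> X (codeset T) ->
    is_type Lp p -> X (codeset p) ->
    con_sat L M T p ->
    exists f r, is_expansion L M f r /\ models (expand M f r) T /\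
                omits (expand M f r) p.

Definition countable_str (M : str) : Prop :=
  exists e : nat -> dom M, forall d, exists n, e n = d.

Definition elem_embedding (Lp : lang) (A B : str) (g : dom A -> dom B) : Prop :=
  forall phi (s : nat -> dom A), wf_form Lp phi ->
    (sat A s phi <-> sat B (fun n => g (s n)) phi).

Definition elem_equiv (Lp : lang) (A B : str) : Prop :=
  forall phi, sentence Lp phi -> (satS A phi <-> satS B phi).

(* Main.v *)
From Stdlib Require Import List Arith PeanoNat Lia Bool Cantor ClassicalEpsilon.
Import ListNotations.
Require Import Defs.

(* Let [M+] be the expansion given by transcendence. If tuples [a] of [M] and [b] of [N] have
   the same [L]-type, they have the same [L+]-type in [M+] and [N]: the type [q] of [a] lies
   in [X], so if [phi] held at [a] but failed at [b], then "[T], omit [p], and some tuple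
   satisfies [q] but not [phi]" would be realized in an expansion of [M], which by
   categoricity is [M+]; an automorphism moving [a] to that tuple preserves [M+] by
   categoricity again, a contradiction. Hence any [L]-elementary embedding of the countable
   [M] into the saturated [N] is [L+]-elementary.

   The existential quantifier over tuples asks for a new symbol, but all symbols may be in
   use. Instead the arity of a symbol of [L+] outside [L] is enlarged so that it also codes a
   set of tuples (if there is no such symbol, [L+] and [L] have the same formulas). This
   makes it necessary to translate [T] and [p] effectively. *)

(** * Functions computable from an oracle *)

(** Programs are handled through the functions they compute: [f] takes the whole argument list, so
    compositions are written as ordinary functions, and only lists of length [n] are constrained. *)
Definition cf (A : nat -> Prop) (n : nat) (f : list nat -> nat) : Prop :=
  exists e, forall v, length v = n -> eval A e v (f v).

Lemma cf_ext A n f g :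
  (forall v, length v = n -> f v = g v) -> cf A n f -> cf A n g.
Proof.
  intros E [e He]; exists e; intros v Hv; rewrite <- (E v Hv); auto.
Qed.

Lemma cf_const A n c : cf A n (fun _ => c).
Proof.
  induction c as [|c [e He]].
  - exists PZero; intros; constructor.
  - exists (PComp PSucc [e]); intros v Hv.
    apply ev_comp with [c]; repeat constructor; auto.
Qed.

Lemma cf_nth A n i : i < n -> cf A n (fun v => nth i v 0).
Proof. intros Hi; exists (PProj i); intros v <-; now constructor. Qed.

Lemma cf_succ A n f : cf A n f -> cf A n (fun v => S (f v)).
Proof.
  intros [e He]; exists (PComp PSucc [e]); intros v Hv.
  apply ev_comp with [f v]; repeat constructor; auto.
Qed.

Lemma cf_comp1 A n g f :
  cf A 1 (fun v => g (nth 0 v 0)) -> cf A n f -> cf A n (fun v => g (f v)).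
Proof.
  intros [eg Hg] [e He]; exists (PComp eg [e]); intros v Hv.
  apply ev_comp with [f v]; [repeat constructor; auto | apply (Hg [f v]); auto].
Qed.

Lemma cf_comp2 A n g f1 f2 :
  cf A 2 (fun v => g (nth 0 v 0) (nth 1 v 0)) ->
  cf A n f1 -> cf A n f2 -> cf A n (fun v => g (f1 v) (f2 v)).
Proof.
  intros [eg Hg] [e1 H1] [e2 H2]; exists (PComp eg [e1; e2]); intros v Hv.
  apply ev_comp with [f1 v; f2 v];
    [repeat constructor; auto | apply (Hg [f1 v; f2 v]); auto].
Qed.

(** The prefix [w] shifts the indices so that the induction goes through. With [w] empty the list is
    copied; with one entry the head is dropped. *)
Lemma evals_proj A v w : evals A (map PProj (seq (length w) (length v))) (w ++ v) v.
Proof.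
  revert w; induction v as [|x v IH]; intros w; simpl; constructor.
  - replace x with (nth (length w) (w ++ x :: v) 0) at 2
      by (rewrite app_nth2, Nat.sub_diag; auto).
    constructor; rewrite length_app; simpl; lia.
  - specialize (IH (w ++ [x])); rewrite length_app, <- app_assoc in IH; simpl in IH.
    now rewrite Nat.add_1_r in IH.
Qed.

Lemma cf_tl A n f : cf A n f -> cf A (S n) (fun v => f (tl v)).
Proof.
  intros [e He]; exists (PComp e (map PProj (seq 1 n))); intros [|x v] Hv; [easy|].
  injection Hv as <-; apply ev_comp with v; [apply (evals_proj A v [x]) | now apply He].
Qed.

Lemma cf_rec A n b s t :
  cf A n b -> cf A (S (S n)) s -> cf A n t ->
  cf A n (fun v => nat_rect (fun _ => nat) (b v) (fun k y => s (k :: y :: v)) (t v)).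
Proof.
  intros [eb Hb] [es Hs] [et Ht].
  exists (PComp (PPrec eb es) (et :: map PProj (seq 0 n))); intros v Hv.
  apply ev_comp with (t v :: v).
  - constructor; [auto|]; subst n; apply (evals_proj A v []).
  - generalize (t v) as k; induction k as [|k IH]; simpl.
    + constructor; auto.
    + eapply ev_precS; [apply IH | apply Hs; simpl; auto].
Qed.

Lemma cf_ifz A n a b c :
  cf A n a -> cf A n b -> cf A n c ->
  cf A n (fun v => match a v with 0 => b v | S _ => c v end).
Proof.
  intros Ha Hb Hc.
  apply cf_ext with (fun v => nat_rect (fun _ => nat) (b v)
    (fun k y => (fun w => c (tl (tl w))) (k :: y :: v)) (a v)).
  - intros v _; now destruct (a v).
  - apply (cf_rec A n b (fun w => c (tl (tl w)))); auto.
    now apply (cf_tl A _ (fun w => c (tl w))), cf_tl.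
Qed.

Lemma cf_add A n f g : cf A n f -> cf A n g -> cf A n (fun v => f v + g v).
Proof.
  apply cf_comp2.
  apply cf_ext with (fun v => nat_rect (fun _ => nat) (nth 1 v 0)
     (fun k y => (fun w => S (nth 1 w 0)) (k :: y :: v)) (nth 0 v 0)).
  - intros v _; induction (nth 0 v 0) as [|k IH]; simpl in *; auto.
  - apply (cf_rec A 2 _ (fun w => S (nth 1 w 0))); try apply cf_succ; apply cf_nth; lia.
Qed.

Lemma cf_pred A n f : cf A n f -> cf A n (fun v => pred (f v)).
Proof.
  apply cf_comp1.
  apply cf_ext with (fun v => nat_rect (fun _ => nat) 0
     (fun k y => (fun w => nth 0 w 0) (k :: y :: v)) (nth 0 v 0)).
  - intros v _; now destruct (nth 0 v 0).
  - apply (cf_rec A 1 _ (fun w => nth 0 w 0)); try apply cf_const; apply cf_nth; lia.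
Qed.

Lemma cf_sub A n f g : cf A n f -> cf A n g -> cf A n (fun v => f v - g v).
Proof.
  apply cf_comp2.
  apply cf_ext with (fun v => nat_rect (fun _ => nat) (nth 0 v 0)
     (fun k y => (fun w => pred (nth 1 w 0)) (k :: y :: v)) (nth 1 v 0)).
  - intros v _; induction (nth 1 v 0) as [|k IH]; cbn [nat_rect]; [lia|].
    rewrite IH; simpl; lia.
  - apply (cf_rec A 2 _ (fun w => pred (nth 1 w 0))); try apply cf_pred; apply cf_nth; lia.
Qed.

Lemma cf_ifeq A n a b c d :
  cf A n a -> cf A n b -> cf A n c -> cf A n d ->
  cf A n (fun v => if a v =? b v then c v else d v).
Proof.
  intros Ha Hb Hc Hd.
  (* Two numbers are equal exactly when both truncated differences vanish. *)
  apply cf_ext with (fun v => match (a v - b v) + (b v - a v) with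
                              | 0 => c v | S _ => d v end).
  - intros v _; destruct (Nat.eqb_spec (a v) (b v)) as [->|Hn].
    + now rewrite Nat.sub_diag.
    + destruct (a v - b v + (b v - a v)) eqn:E; [lia | reflexivity].
  - apply cf_ifz; auto; apply cf_add; apply cf_sub; auto.
Qed.

(** * Cantor pairing and its inverses *)

Definition pfst (n : nat) : nat := fst (of_nat n).
Definition psnd (n : nat) : nat := snd (of_nat n).

(** Triangular numbers, in the form in which they occur in [to_nat], so that [cpair_tri] is
    [cpair_to_nat] up to conversion. *)
Definition tri (m : nat) : nat := nat_rect (fun _ => nat) 0 (fun i t => S i + t) m.

Lemma cpair_to_nat a b : cpair a b = to_nat (a, b).
Proof.
  unfold cpair; pose proof (to_nat_spec a b) as H.
  replace ((a + b) * (a + b + 1)) with ((to_nat (a, b) - b) * 2) by nia.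
  rewrite Nat.div_mul by lia; nia.
Qed.

Lemma pfst_cpair a b : pfst (cpair a b) = a.
Proof. unfold pfst; now rewrite cpair_to_nat, cancel_of_to. Qed.

Lemma psnd_cpair a b : psnd (cpair a b) = b.
Proof. unfold psnd; now rewrite cpair_to_nat, cancel_of_to. Qed.

Lemma cpair_tri a b : cpair a b = b + tri (b + a).
Proof. now rewrite cpair_to_nat. Qed.

Lemma pair_surj n : n = psnd n + tri (psnd n + pfst n).
Proof.
  rewrite <- (cancel_to_of n) at 1; unfold psnd, pfst.
  now destruct (of_nat n).
Qed.

Lemma cpair_ge_r a b : b <= cpair a b.
Proof. rewrite cpair_tri; lia. Qed.

Lemma tri_ge m : m <= tri m.
Proof. induction m; simpl in *; lia. Qed.

Lemma cpair_ge_l a b : a <= cpair a b.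
Proof. rewrite cpair_tri; pose proof (tri_ge (b + a)); lia. Qed.

Lemma cpair_gt_r a b : b < cpair (S a) b.
Proof. rewrite cpair_tri; pose proof (tri_ge (b + S a)); lia. Qed.

(** The sum of the components of the [n]th pair, by primitive recursion and without search: it grows
    by one exactly when the offset [k - tri y] has reached the end [y] of the diagonal. *)
Definition diag (n : nat) : nat :=
  nat_rect (fun _ => nat) 0
    (fun k y => match y - (k - tri y) with 0 => S y | S _ => y end) n.

Lemma diag_sum n : diag n = psnd n + pfst n.
Proof.
  induction n as [|n IH]; [reflexivity|].
  change (diag (S n)) with
    (match diag n - (n - tri (diag n)) with 0 => S (diag n) | S _ => diag n end).
  rewrite IH.
  replace (n - tri (psnd n + pfst n)) with (psnd n) by (pose proof (pair_surj n); lia).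
  unfold psnd, pfst; simpl of_nat at 5 6.
  change (of_nat (S n)) with
    (let '(x, y) := of_nat n in match x with S i => (i, S y) | _ => (S y, 0) end).
  destruct (of_nat n) as [[|x] y]; simpl fst; simpl snd.
  - now rewrite Nat.add_0_r, Nat.sub_diag.
  - replace (y + S x - y) with (S x) by lia; lia.
Qed.

Lemma cf_tri A n f : cf A n f -> cf A n (fun v => tri (f v)).
Proof.
  apply cf_comp1, (cf_rec A 1 (fun _ => 0) (fun w => S (nth 0 w 0) + nth 1 w 0));
    repeat first [apply cf_add | apply cf_succ | apply cf_const | apply cf_nth]; lia.
Qed.

Lemma cf_diag A n f : cf A n f -> cf A n (fun v => diag (f v)).
Proof.
  apply cf_comp1, (cf_rec A 1 (fun _ => 0)
    (fun w => match nth 1 w 0 - (nth 0 w 0 - tri (nth 1 w 0)) with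
              | 0 => S (nth 1 w 0) | S _ => nth 1 w 0 end));
    repeat first [apply cf_ifz | apply cf_sub | apply cf_tri | apply cf_succ
                 | apply cf_const | apply cf_nth]; lia.
Qed.

Lemma cf_psnd A n f : cf A n f -> cf A n (fun v => psnd (f v)).
Proof.
  intros Hf; apply cf_ext with (fun v => f v - tri (diag (f v))).
  - intros v _; rewrite diag_sum; pose proof (pair_surj (f v)); lia.
  - apply cf_sub; auto; now apply cf_tri, cf_diag.
Qed.

Lemma cf_pfst A n f : cf A n f -> cf A n (fun v => pfst (f v)).
Proof.
  intros Hf; apply cf_ext with (fun v => diag (f v) - psnd (f v)).
  - intros v _; rewrite diag_sum; lia.
  - apply cf_sub; [now apply cf_diag | now apply cf_psnd].
Qed.

Lemma cf_cpair A n f g : cf A n f -> cf A n g -> cf A n (fun v => cpair (f v) (g v)).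
Proof.
  intros Hf Hg; apply cf_ext with (fun v => g v + tri (g v + f v)).
  - intros v _; now rewrite cpair_tri.
  - apply cf_add; auto; now apply cf_tri, cf_add.
Qed.

(* Course-of-values recursion: [hist step x] codes the values below [x], latest first,
   and [look x h j] reads off the [j]th one. *)
Definition hist (step : nat -> nat -> nat) (x : nat) : nat :=
  nat_rect (fun _ => nat) 0 (fun k h => cpair (step k h) h) x.

Definition cov (step : nat -> nat -> nat) (x : nat) : nat := step x (hist step x).

Definition look (x h j : nat) : nat := pfst (Nat.iter (x - 1 - j) psnd h).

Lemma look_hist step x j : j < x -> look x (hist step x) j = cov step j.
Proof.
  intros Hj; unfold look.
  (* Dropping the values later than the [j]th leaves the history as it was built just after step
     [j]. *)
  cut (Nat.iter (x - 1 - j) psnd (hist step x) = cpair (cov step j) (hist step j)).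
  { intros ->; apply pfst_cpair. }
  induction x as [|x IH]; [lia|].
  destruct (Nat.eq_dec j x) as [->|Hn].
  - now replace (S x - 1 - x) with 0 by lia.
  - replace (S x - 1 - j) with (S (x - 1 - j)) by lia.
    rewrite Nat.iter_succ_r; simpl hist at 1.
    rewrite psnd_cpair; apply IH; lia.
Qed.

Lemma cf_cov A n step f :
  cf A 2 (fun v => step (nth 0 v 0) (nth 1 v 0)) ->
  cf A n f -> cf A n (fun v => cov step (f v)).
Proof.
  intros Hs; apply cf_comp1; unfold cov.
  apply (cf_comp2 A 1 step); auto; [apply cf_nth; lia|].
  apply (cf_rec A 1 (fun _ => 0)
    (fun w => cpair (step (nth 0 w 0) (nth 1 w 0)) (nth 1 w 0)));
    [apply cf_const | | apply cf_nth; lia].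
  apply cf_cpair; [|apply cf_nth; lia].
  apply (cf_comp2 A 3 step); auto; apply cf_nth; lia.
Qed.

Lemma cf_look A n f g h :
  cf A n f -> cf A n g -> cf A n h -> cf A n (fun v => look (f v) (g v) (h v)).
Proof.
  intros Hf Hg Hh; unfold look; apply cf_pfst.
  apply (cf_comp2 A n (fun a b => Nat.iter a psnd b)); auto.
  - apply (cf_rec A 2 (fun v => nth 1 v 0) (fun w => psnd (nth 1 w 0)));
      try apply cf_psnd; apply cf_nth; lia.
  - apply cf_sub; auto; apply cf_sub; auto; apply cf_const.
Qed.

Ltac cf_step :=
  first
    [ assumption | apply cf_const | apply cf_nth; simpl; lia | apply cf_ifeq | apply cf_look
    | apply cf_cpair | apply cf_pfst | apply cf_psnd | apply cf_pred | apply cf_succ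
    | apply cf_sub | apply cf_add ].

Ltac cf_tac := repeat cf_step.

(** * Turing reducibility through characteristic functions *)

Definition chi (A : nat -> Prop) (x : nat) : nat :=
  if excluded_middle_informative (A x) then 1 else 0.

Lemma chi_true A x : A x -> chi A x = 1.
Proof. unfold chi; destruct excluded_middle_informative; tauto. Qed.

Lemma chi_false A x : ~ A x -> chi A x = 0.
Proof. unfold chi; destruct excluded_middle_informative; tauto. Qed.

Lemma chi_ext A B x y : (A x <-> B y) -> chi A x = chi B y.
Proof. unfold chi; repeat destruct excluded_middle_informative; tauto. Qed.

Lemma cf_oracle A n f : cf A n f -> cf A n (fun v => chi A (f v)).
Proof.
  apply cf_comp1; exists POrc; intros [|x [|]] Hv; try easy; simpl.
  unfold chi; destruct excluded_middle_informative; now constructor.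
Qed.

Lemma Treducible_iff_cf B A : Treducible B A <-> cf A 1 (fun v => chi B (nth 0 v 0)).
Proof.
  split.
  - intros [e He]; exists e; intros [|x [|]] Hv; try easy; simpl.
    unfold chi; destruct excluded_middle_informative; now apply He.
  - intros [e He]; exists e; intros x; specialize (He [x] eq_refl); simpl in He.
    split; intros Hx; [rewrite chi_true in He | rewrite chi_false in He]; auto.
Qed.

Lemma Treducible_ext A B : (forall x, A x <-> B x) -> Treducible B A.
Proof.
  intros E; apply Treducible_iff_cf.
  apply cf_ext with (fun v => chi A (nth 0 v 0)).
  - intros v _; apply chi_ext, E.
  - apply cf_oracle; cf_tac.
Qed.

Lemma Treducible_single A c : Treducible (fun k => k = c) A.
Proof.
  apply Treducible_iff_cf.
  apply cf_ext with (fun v => if nth 0 v 0 =? c then 1 else 0); [|cf_tac].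
  intros v _; destruct (Nat.eqb_spec (nth 0 v 0) c);
    symmetry; [now apply chi_true | now apply chi_false].
Qed.

Definition set_ar (ar : nat -> option nat) (i a : nat) : nat -> option nat :=
  fun j => if j =? i then Some a else ar j.

Lemma recursive_set_ar ar i a :
  recursive_set (graph_set ar) -> recursive_set (graph_set (set_ar ar i a)).
Proof.
  intros H; apply Treducible_iff_cf in H; apply Treducible_iff_cf.
  (* Only codes with first component [i] are affected. The graph records arity [a] as [S a], since 0
     stands for an absent symbol. *)
  apply cf_ext with (fun v => if nth 0 v 0 =? cpair i (S a) then 1
    else if pfst (nth 0 v 0) =? i then 0 else chi (graph_set ar) (nth 0 v 0)); [|cf_tac].
  intros v _; generalize (nth 0 v 0) as k; intros k.
  destruct (Nat.eqb_spec k (cpair i (S a))) as [->|Hk].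
  - symmetry; apply chi_true; exists i; unfold set_ar; now rewrite Nat.eqb_refl.
  - destruct (Nat.eqb_spec (pfst k) i) as [Hi|Hi].
    + symmetry; apply chi_false; intros [j Hj].
      subst k; rewrite pfst_cpair in Hi; subst j.
      unfold set_ar in Hk; rewrite Nat.eqb_refl in Hk; auto.
    + apply chi_ext; unfold graph_set, set_ar; split; intros [j ->]; exists j;
        rewrite pfst_cpair in Hi; apply Nat.eqb_neq in Hi; now rewrite Hi.
Qed.

(** * Effective translation of formulas *)

Lemma term_nested_ind (P : term -> Prop) :
  (forall n, P (tvar n)) -> (forall f l, Forall P l -> P (tapp f l)) -> forall t, P t.
Proof.
  intros Hv Ha; fix IH 1; intros [n|f l]; [apply Hv|].
  apply Ha; induction l as [|t l IHl]; constructor; [apply IH | exact IHl].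
Qed.

Lemma wf_terms_Forall L l : wf_terms L l <-> Forall (wf_term L) l.
Proof. induction l; simpl; rewrite ?Forall_cons_iff, ?IHl; intuition. Qed.

Section Padding.

(* Arguments [tvar 0] are prepended, [K] of them, to every occurrence of one symbol: the
   function symbol [i] if [isf], the relation symbol [i] otherwise. *)
Variables (isf : bool) (i K : nat).

Definition padf (j : nat) : nat := if isf && (j =? i) then K else 0.
Definition padr (j : nat) : nat := if negb isf && (j =? i) then K else 0.

(** The pads are equal to one another; in the structures built later, equal pads mean that the
    symbol keeps its original meaning. Padding may make variable 0 free. *)
Fixpoint tr_term (t : term) : term :=
  match t with
  | tvar n => tvar n
  | tapp f l => tapp f (repeat (tvar 0) (padf f) ++ map tr_term l)
  end.

Fixpoint tr (phi : form) : form :=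
  match phi with
  | Feq t1 t2 => Feq (tr_term t1) (tr_term t2)
  | Frel r l => Frel r (repeat (tvar 0) (padr r) ++ map tr_term l)
  | Fneg a => Fneg (tr a)
  | Fand a b => Fand (tr a) (tr b)
  | Fex x a => Fex x (tr a)
  end.

(* The conjunct [Fex n (n = n)] records the code of [phi], so that membership in the
   translation of a set can be decided from the set. *)
Definition stamp (phi : form) : form :=
  let n := code phi in Fand (tr phi) (Fex n (Feq (tvar n) (tvar n))).

Definition pad_code (k c : nat) : nat :=
  Nat.iter k (fun d => S (cpair (code_term (tvar 0)) d)) c.

Lemma code_terms_pad k l :
  code_terms (repeat (tvar 0) k ++ l) = pad_code k (code_terms l).
Proof. induction k as [|k IH]; simpl; [auto | now rewrite <- IH]. Qed.

(* [y] is the code of the translated argument list of the term coded by [u]. *)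
Definition tr_term_step (u y : nat) : nat :=
  if pfst u =? 0 then u
  else cpair 1 (cpair (pfst (psnd u))
    (if isf then if pfst (psnd u) =? i then pad_code K y else y else y)).

(** Terms and argument lists are nested in each other, but recursion on the codes of lists is
    enough: the arguments of the head term form a list with a smaller code, whose translation is
    already in the history. *)
Definition tr_list_step (x h : nat) : nat :=
  if x =? 0 then 0
  else S (cpair (tr_term_step (pfst (pred x)) (look x h (psnd (psnd (pfst (pred x))))))
                (look x h (psnd (pred x)))).

Definition tr_list_code : nat -> nat := cov tr_list_step.

Definition tr_term_code (u : nat) : nat :=
  tr_term_step u (tr_list_code (psnd (psnd u))).

Definition tr_step (x h : nat) : nat :=
  let y := psnd x in
  if pfst x =? 0 then cpair 0 (cpair (tr_term_code (pfst y)) (tr_term_code (psnd y)))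
  else if pfst x =? 1 then
    cpair 1 (cpair (pfst y)
      (if isf then tr_list_code (psnd y)
       else if pfst y =? i then pad_code K (tr_list_code (psnd y))
       else tr_list_code (psnd y)))
  else if pfst x =? 2 then cpair 2 (look x h y)
  else if pfst x =? 3 then cpair 3 (cpair (look x h (pfst y)) (look x h (psnd y)))
  else cpair 4 (cpair (pfst y) (look x h (psnd y))).

Definition tr_code : nat -> nat := cov tr_step.

Lemma cf_pad_code A n k f : cf A n f -> cf A n (fun v => pad_code k (f v)).
Proof. intros Hf; induction k as [|k IH]; simpl; cf_tac. Qed.

Lemma cf_tr_term_step A n f g :
  cf A n f -> cf A n g -> cf A n (fun v => tr_term_step (f v) (g v)).
Proof.
  intros Hf Hg; unfold tr_term_step; destruct isf; cf_tac; now apply cf_pad_code.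
Qed.

Lemma cf_tr_list_code A n f : cf A n f -> cf A n (fun v => tr_list_code (f v)).
Proof.
  intros Hf; apply cf_cov; auto; unfold tr_list_step.
  repeat first [apply cf_tr_term_step | cf_step].
Qed.

Lemma cf_tr_term_code A n f : cf A n f -> cf A n (fun v => tr_term_code (f v)).
Proof.
  intros Hf; apply cf_tr_term_step; auto; apply cf_tr_list_code; cf_tac.
Qed.

Lemma cf_tr_code A n f : cf A n f -> cf A n (fun v => tr_code (f v)).
Proof.
  intros Hf; apply cf_cov; auto; unfold tr_step; cbv zeta.
  destruct isf;
  repeat first [apply cf_tr_term_code | apply cf_tr_list_code | apply cf_pad_code | cf_step].
Qed.


Lemma tr_term_code_app f l :
  tr_list_code (code_terms l) = code_terms (map tr_term l) ->
  tr_term_code (code_term (tapp f l)) = code_term (tr_term (tapp f l)).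
Proof.
  intros IH; unfold tr_term_code, tr_term_step; simpl code_term.
  rewrite !pfst_cpair, !psnd_cpair, pfst_cpair; simpl Nat.eqb; cbv iota.
  change (fold_right _ 0 l) with (code_terms l).
  change (fold_right _ 0 ?l) with (code_terms l).
  rewrite IH, code_terms_pad; unfold padf.
  destruct isf; simpl; [destruct (f =? i)|]; reflexivity.
Qed.

Lemma code_app_gt f l : code_terms l < code_term (tapp f l).
Proof.
  simpl; change (fold_right _ 0 l) with (code_terms l).
  pose proof (cpair_gt_r 0 (cpair f (code_terms l))).
  pose proof (cpair_ge_r f (code_terms l)); lia.
Qed.

Lemma tr_list_code_cons u c :
  tr_list_code (S (cpair u c)) =
  S (cpair (tr_term_step u (look (S (cpair u c)) (hist tr_list_step (S (cpair u c)))
       (psnd (psnd u)))) (tr_list_code c)).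
Proof.
  unfold tr_list_code at 1, cov; unfold tr_list_step at 1; simpl Nat.eqb; cbv iota.
  cbn [pred]; rewrite pfst_cpair, psnd_cpair; f_equal; f_equal.
  apply look_hist; pose proof (cpair_ge_r u c); lia.
Qed.

Lemma tr_list_code_correct l :
  Forall (fun t => tr_term_code (code_term t) = code_term (tr_term t)) l ->
  tr_list_code (code_terms l) = code_terms (map tr_term l).
Proof.
  induction 1 as [|t l Ht _ IH]; [reflexivity|].
  change (code_terms (t :: l)) with (S (cpair (code_term t) (code_terms l))).
  rewrite tr_list_code_cons, IH.
  change (code_terms (map tr_term (t :: l))) with
    (S (cpair (code_term (tr_term t)) (code_terms (map tr_term l)))).
  rewrite <- Ht; f_equal; f_equal.
  (* The translation of a variable does not consult the history; for an application, [code_app_gt]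
     puts the argument list below the current list. *)
  destruct t as [n|f l'].
  - unfold tr_term_code, tr_term_step; simpl code_term; now rewrite pfst_cpair.
  - unfold tr_term_code; rewrite look_hist; [reflexivity|].
    pose proof (code_app_gt f l') as Hlt.
    simpl code_term in *; rewrite !psnd_cpair in *.
    pose proof (cpair_ge_l (cpair 1 (cpair f (code_terms l'))) (code_terms l)).
    change (fold_right _ 0 l') with (code_terms l') in *; lia.
Qed.

Lemma tr_term_code_correct t : tr_term_code (code_term t) = code_term (tr_term t).
Proof.
  induction t as [n|f l IH] using term_nested_ind.
  - unfold tr_term_code, tr_term_step; simpl code_term; now rewrite pfst_cpair.
  - now apply tr_term_code_app, tr_list_code_correct.
Qed.

(** The tags of negation, conjunction and quantifier are nonzero, so subformulas have strictly
    smaller codes and every lookup in the history is in range. *)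
Lemma tr_code_correct phi : tr_code (code phi) = code (tr phi).
Proof.
  assert (Hl : forall l, tr_list_code (code_terms l) = code_terms (map tr_term l)).
  { intros l; apply tr_list_code_correct, Forall_forall; intros; apply tr_term_code_correct. }
  induction phi as [t1 t2|r l|a IHa|a IHa b IHb|x a IHa]; simpl code;
    unfold tr_code at 1, cov; unfold tr_step at 1; cbv zeta;
    repeat rewrite ?pfst_cpair, ?psnd_cpair; simpl Nat.eqb; cbv iota.
  - now rewrite !tr_term_code_correct.
  - rewrite Hl, code_terms_pad; unfold padr.
    destruct isf; simpl; [|destruct (r =? i)]; reflexivity.
  - rewrite look_hist by apply cpair_gt_r.
    change (cov tr_step) with tr_code; now rewrite IHa.
  - pose proof (cpair_gt_r 2 (cpair (code a) (code b))).
    pose proof (cpair_ge_l (code a) (code b)); pose proof (cpair_ge_r (code a) (code b)).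
    rewrite !look_hist by lia.
    change (cov tr_step) with tr_code; now rewrite IHa, IHb.
  - pose proof (cpair_gt_r 3 (cpair x (code a))); pose proof (cpair_ge_r x (code a)).
    rewrite !look_hist by lia.
    change (cov tr_step) with tr_code; now rewrite IHa.
Qed.

End Padding.

(** * Closure of Scott sets under operations on formulas *)

Definition image (F : form -> form) (S : form -> Prop) : form -> Prop :=
  fun psi => exists phi, S phi /\ psi = F phi.

Fixpoint exs (xs : list nat) (phi : form) : form :=
  match xs with
  | [] => phi
  | x :: xs => Fex x (exs xs phi)
  end.

Section ScottSet.

Variable X : (nat -> Prop) -> Prop.
Hypothesis HX : scott_set X.

Lemma scott_reducible A B : Treducible B A -> X A -> X B.
Proof. intros H HA; destruct HX as (_ & _ & _ & H4 & _); eauto. Qed.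

Lemma scott_ext A B : (forall k, A k <-> B k) -> X A -> X B.
Proof. intros E; apply scott_reducible, Treducible_ext, E. Qed.

Lemma scott_union S1 S2 :
  X (codeset S1) -> X (codeset S2) -> X (codeset (fun phi => S1 phi \/ S2 phi)).
Proof.
  intros H1 H2; destruct HX as (_ & HU & _).
  apply (scott_ext (fun k => codeset S1 k \/ codeset S2 k)); auto.
  intros k; unfold codeset; split.
  - intros [(phi & ? & ?)|(phi & ? & ?)]; eauto.
  - intros (phi & [?|?] & ?); eauto.
Qed.

Lemma scott_single chi0 : X (codeset (fun phi => phi = chi0)).
Proof.
  destruct HX as ([A HA] & _).
  apply (scott_ext (fun k => k = code chi0)).
  - intros k; unfold codeset; split; [intros ->; eauto | intros (? & -> & ?); auto].
  - apply (scott_reducible A); auto; apply Treducible_single.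
Qed.

(** The decoder [u] leaves a single candidate for the code of a preimage: [k] codes a formula of the
    image exactly when [h (u k) = k] and [u k] codes a formula of [S]. This takes one query to the
    oracle. *)
Lemma scott_image F h u S :
  (forall phi, code (F phi) = h (code phi)) -> (forall n, u (h n) = n) ->
  (forall A, cf A 1 (fun v => h (nth 0 v 0))) ->
  (forall A, cf A 1 (fun v => u (nth 0 v 0))) ->
  X (codeset S) -> X (codeset (image F S)).
Proof.
  intros HF Hu Ch Cu; apply scott_reducible, Treducible_iff_cf.
  apply cf_ext with (fun v => if h (u (nth 0 v 0)) =? nth 0 v 0
                              then chi (codeset S) (u (nth 0 v 0)) else 0).
  - intros v _; generalize (nth 0 v 0) as k; intros k.
    destruct (Nat.eqb_spec (h (u k)) k) as [E|E].
    + apply chi_ext; split.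
      * intros (phi & Hp & Hk); exists (F phi); split; [now exists phi|].
        now rewrite HF, Hk, E.
      * intros (? & (phi & Hp & ->) & Hk); exists phi; split; auto.
        now rewrite <- Hk, HF, Hu.
    + symmetry; apply chi_false; intros (? & (phi & Hp & ->) & Hk).
      apply E; now rewrite <- Hk, HF, Hu.
  - cf_tac; [apply (cf_comp1 _ 1 h); auto | apply cf_oracle; auto].
Qed.

Lemma scott_image_neg S : X (codeset S) -> X (codeset (image Fneg S)).
Proof.
  apply scott_image with (h := cpair 2) (u := psnd); auto using psnd_cpair;
    intros A; cf_tac.
Qed.

Lemma scott_image_and chi0 S : X (codeset S) -> X (codeset (image (Fand chi0) S)).
Proof.
  apply scott_image with (h := fun n => cpair 3 (cpair (code chi0) n))
                         (u := fun k => psnd (psnd k)).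
  1, 2: intros; now rewrite ?psnd_cpair.
  all: intros A; cf_tac.
Qed.

Lemma scott_image_ex x S : X (codeset S) -> X (codeset (image (Fex x) S)).
Proof.
  apply scott_image with (h := fun n => cpair 4 (cpair x n))
                         (u := fun k => psnd (psnd k)).
  1, 2: intros; now rewrite ?psnd_cpair.
  all: intros A; cf_tac.
Qed.

Lemma scott_image_comp F G S :
  X (codeset (image F (image G S))) -> X (codeset (image (fun phi => F (G phi)) S)).
Proof.
  apply scott_ext; intros k; unfold codeset, image; split.
  - intros (? & (? & (phi & Hp & ->) & ->) & Hk); eauto.
  - intros (? & (phi & Hp & ->) & Hk); eauto 7.
Qed.

Lemma scott_image_exs xs S : X (codeset S) -> X (codeset (image (exs xs) S)).
Proof.
  intros HS; induction xs as [|x xs IH].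
  - revert HS; apply scott_ext; intros k; unfold codeset, image; simpl; split.
    + intros (phi & ? & ?); eauto.
    + intros (? & (phi & ? & ->) & ?); eauto.
  - now apply (scott_image_comp (Fex x) (exs xs)), scott_image_ex.
Qed.

(** The decoder reads the original code off the stamp, as the variable bound by its quantifier, so
    [tr] never has to be inverted. *)
Lemma scott_image_stamp isf i K S :
  X (codeset S) -> X (codeset (image (stamp isf i K) S)).
Proof.
  apply scott_image with (u := fun k => pfst (psnd (psnd (psnd k))))
    (h := fun n => cpair 3 (cpair (tr_code isf i K n)
       (cpair 4 (cpair n (cpair 0 (cpair (cpair 0 n) (cpair 0 n))))))).
  - intros phi; unfold stamp; simpl; now rewrite tr_code_correct.
  - intros n; now rewrite !psnd_cpair, pfst_cpair.
  - intros A; repeat first [apply cf_tr_code | cf_step].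
  - intros A; cf_tac.
Qed.

End ScottSet.

(** * Structures and elementary embeddings *)

Lemma upd_eq {D} (s : nat -> D) x d : upd s x d x = d.
Proof. unfold upd; now rewrite Nat.eqb_refl. Qed.

Lemma upd_neq {D} (s : nat -> D) x d y : y <> x -> upd s x d y = s y.
Proof. intros H; unfold upd; now apply Nat.eqb_neq in H as ->. Qed.

Lemma upd_agree {C D} (g : C -> D) s t x d e y :
  g d = e -> (y <> x -> g (s y) = t y) -> g (upd s x d y) = upd t x e y.
Proof.
  intros Hd H; destruct (Nat.eq_dec y x) as [->|Hn].
  - now rewrite !upd_eq.
  - rewrite !upd_neq; auto.
Qed.

(** Only the symbols of [L], at their arities, are compared. The identity can thus be an isomorphism
    between structures that differ outside [L], and [sat_iso] covers expansions and equal
    interpretations as well. *)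
Definition isomorphism (L : lang) (P R : str) (g : dom P -> dom R) : Prop :=
  (forall d, exists c, g c = d) /\
  (forall c c', g c = g c' -> c = c') /\
  (forall j l, fun_ar L j = Some (length l) -> g (fn P j l) = fn R j (map g l)) /\
  (forall j l, rel_ar L j = Some (length l) -> (rl P j l <-> rl R j (map g l))).

Lemma teval_iso L P R g s t u :
  isomorphism L P R g -> wf_term L u ->
  (forall x, In x (fv_term u) -> g (s x) = t x) -> g (teval P s u) = teval R t u.
Proof.
  intros (_ & _ & Hf & _); induction u as [n|f l IH] using term_nested_ind; simpl.
  - auto.
  - change (fold_right _ True l) with (wf_terms L l); rewrite wf_terms_Forall.
    intros [Ha Hl] Hs; rewrite Hf, map_map by now rewrite length_map.
    f_equal; apply map_ext_in; intros u Hu.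
    rewrite Forall_forall in IH, Hl; apply IH; auto.
    intros x Hx; apply Hs, in_flat_map; eauto.
Qed.

Lemma sat_iso L P R g phi : isomorphism L P R g -> wf_form L phi ->
  forall s t, (forall x, In x (fv phi) -> g (s x) = t x) -> (sat P s phi <-> sat R t phi).
Proof.
  intros Hg; pose proof Hg as (Hsur & Hinj & _ & Hr).
  induction phi as [t1 t2|r l|a IHa|a IHa b IHb|x a IHa]; simpl; intros Hw s t Hs.
  - rewrite <- (teval_iso L P R g s t t1), <- (teval_iso L P R g s t t2)
      by (tauto || (intros; apply Hs, in_app_iff; auto)).
    split; [now intros -> | apply Hinj].
  - destruct Hw as [Ha Hl]; rewrite wf_terms_Forall in Hl.
    rewrite Hr, map_map by now rewrite length_map.
    replace (map (fun u => g (teval P s u)) l) with (map (teval R t) l); [tauto|].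
    apply map_ext_in; intros u Hu; symmetry.
    rewrite Forall_forall in Hl; apply (teval_iso L); auto.
    intros x Hx; apply Hs, in_flat_map; eauto.
  - now rewrite (IHa Hw s t Hs).
  - rewrite (IHa (proj1 Hw) s t), (IHb (proj2 Hw) s t); [tauto| |];
      intros; apply Hs, in_app_iff; auto.
  - split.
    + intros [d Hd]; exists (g d); revert Hd; apply IHa; auto.
      intros y Hy; apply upd_agree; auto; intros Hn; apply Hs, in_in_remove; auto.
    + intros [e He]; destruct (Hsur e) as [d Hd]; exists d; revert He; apply IHa; auto.
      intros y Hy; apply upd_agree; auto; intros Hn; apply Hs, in_in_remove; auto.
Qed.

Lemma teval_coinc P s t u :
  (forall x, In x (fv_term u) -> s x = t x) -> teval P s u = teval P t u.
Proof.
  induction u as [n|f l IH] using term_nested_ind; simpl; intros Hs; [auto|].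
  f_equal; apply map_ext_in; intros u Hu; rewrite Forall_forall in IH; apply IH; auto.
  intros x Hx; apply Hs, in_flat_map; eauto.
Qed.

Lemma sat_coinc P phi : forall s t,
  (forall x, In x (fv phi) -> s x = t x) -> (sat P s phi <-> sat P t phi).
Proof.
  induction phi as [t1 t2|r l|a IHa|a IHa b IHb|x a IHa]; simpl; intros s t Hs.
  - rewrite (teval_coinc P s t t1), (teval_coinc P s t t2); [tauto| |];
      intros; apply Hs, in_app_iff; auto.
  - replace (map (teval P s) l) with (map (teval P t) l); [tauto|].
    apply map_ext_in; intros u Hu; symmetry; apply teval_coinc.
    intros x Hx; apply Hs, in_flat_map; eauto.
  - now rewrite (IHa s t Hs).
  - rewrite (IHa s t), (IHb s t); [tauto| |]; intros; apply Hs, in_app_iff; auto.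
  - split; intros [d Hd]; exists d; revert Hd; apply IHa; intros y Hy;
      apply (upd_agree (fun c => c)); auto; intros Hn;
      [symmetry|]; apply Hs, in_in_remove; auto.
Qed.

Lemma sat_sentence P s t phi : fv phi = [] -> (sat P s phi <-> sat P t phi).
Proof. intros H; apply sat_coinc; rewrite H; easy. Qed.

Lemma is_expansion_isomorphism L M f r :
  is_expansion L M f r -> isomorphism L (expand M f r) M (fun d => d).
Proof.
  intros [Hf Hr]; split; [eauto|split; [auto|split]]; intros j l Hj; rewrite map_id.
  - now apply (Hf j (length l)).
  - now apply (Hr j (length l)).
Qed.

Lemma sat_expansion L M f r phi s :
  is_expansion L M f r -> wf_form L phi -> (sat (expand M f r) s phi <-> sat M s phi).
Proof.
  intros H Hw; apply (sat_iso L (expand M f r) M (fun d => d)); auto.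
  now apply is_expansion_isomorphism.
Qed.

Lemma sat_same_interp Lp M f1 r1 f2 r2 phi s :
  same_interp Lp f1 f2 r1 r2 -> wf_form Lp phi ->
  (sat (expand M f1 r1) s phi <-> sat (expand M f2 r2) s phi).
Proof.
  intros [Hf Hr] Hw.
  apply (sat_iso Lp (expand M f1 r1) (expand M f2 r2) (fun d => d)); auto.
  split; [eauto|split; [auto|split]]; intros j l Hj; rewrite map_id.
  - now apply (Hf j (length l)).
  - now apply (Hr j (length l)).
Qed.

Lemma models_Th_iff L M N phi s t :
  models_Th L M N -> wf_form L phi -> fv phi = [] -> (sat M s phi <-> sat N t phi).
Proof.
  intros H Hw Hv.
  rewrite (sat_sentence M s (fun _ => inh M)), (sat_sentence N t (fun _ => inh N)) by auto.
  split; [apply (H phi); now split|].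
  intros Hn; apply NNPP; intros Hm; now apply (H (Fneg phi)) in Hm.
Qed.

(** * Free variables, existential closures and renaming *)

Lemma remove_incl_cons x (l xs : list nat) :
  incl (remove Nat.eq_dec x l) xs <-> incl l (x :: xs).
Proof.
  split; intros H y Hy.
  - destruct (Nat.eq_dec y x) as [->|Hn]; [now left|].
    right; apply H, in_in_remove; auto.
  - apply in_remove in Hy as [Hy Hn]; now destruct (H y Hy) as [<-|].
Qed.

Lemma fv_exs xs : forall phi ys, incl (fv (exs xs phi)) ys <-> incl (fv phi) (xs ++ ys).
Proof.
  induction xs as [|x xs IH]; intros phi ys; [reflexivity|].
  simpl exs; simpl fv; rewrite remove_incl_cons, IH.
  split; intros H y Hy; specialize (H y Hy); simpl in *; rewrite in_app_iff in *;
    simpl in *; tauto.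
Qed.

Lemma fv_exs_closed xs phi : incl (fv phi) xs -> fv (exs xs phi) = [].
Proof.
  intros H; apply incl_l_nil, fv_exs; now rewrite app_nil_r.
Qed.

Lemma wf_exs L xs phi : wf_form L (exs xs phi) <-> wf_form L phi.
Proof. induction xs; simpl; tauto. Qed.

Lemma sat_exs P xs phi s0 : incl (fv phi) xs ->
  (sat P s0 (exs xs phi) <-> exists s, sat P s phi).
Proof.
  (* The induction uses a sharper form without the assumption on free variables: the assignment
     changes only at [xs]. *)
  intros Hi; assert (H : forall s0, sat P s0 (exs xs phi) <->
    exists s, (forall x, ~ In x xs -> s x = s0 x) /\ sat P s phi).
  - clear s0 Hi; induction xs as [|x xs IH]; intros s0; simpl.
    + split; [now exists s0|]; intros (s & Hs & H); revert H.
      apply sat_coinc; intros x _; symmetry; now apply Hs.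
    + split.
      * intros [d Hd]; apply IH in Hd as (s & Hs & H); exists s; split; auto.
        intros y Hy; rewrite Hs by tauto; apply upd_neq; intros ->; tauto.
      * intros (s & Hs & H); exists (s x); apply IH; exists s; split; auto.
        intros y Hy; destruct (Nat.eq_dec y x) as [->|Hn]; [now rewrite upd_eq|].
        rewrite upd_neq by auto; apply Hs; intros [|]; auto.
  - rewrite H; split; [intros (s & _ & Hs); eauto|].
    intros [s Hs].
    exists (fun x => if in_dec Nat.eq_dec x xs then s x else s0 x); split.
    + intros x Hx; destruct in_dec; tauto.
    + revert Hs; apply sat_coinc; intros x Hx; destruct in_dec; auto.
      now apply Hi in Hx.
Qed.

(** Positivity of [n] is used later: the padding variable 0 has to be among the first [n]
    variables. *)
Lemma seq_bound (l : list nat) : exists n, 0 < n /\ incl l (seq 0 n).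
Proof.
  exists (S (list_max l)); split; [lia|]; intros x Hx; apply in_seq.
  pose proof (proj1 (list_max_le l (list_max l)) (le_n _)) as H.
  rewrite Forall_forall in H; specialize (H x Hx); lia.
Qed.

Lemma fresh_var (l : list nat) : exists z, ~ In z l.
Proof.
  destruct (seq_bound l) as (n & _ & Hn); exists n; intros H.
  apply Hn, in_seq in H; lia.
Qed.

(** Simultaneous substitution of variables, not necessarily injective. In [countable_embedding] it
    replaces an arbitrary assignment by a fixed enumeration of elements. *)
Lemma form_rename L phi : forall k : nat -> nat, wf_form L phi ->
  exists psi, wf_form L psi /\ incl (fv psi) (map k (fv phi)) /\
    forall P (s : nat -> dom P), sat P s psi <-> sat P (fun x => s (k x)) phi.
Proof.
  set (rn := fun k => fix rn (t : term) : term :=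
    match t with tvar n => tvar (k n) | tapp f l => tapp f (map rn l) end).
  assert (Hwf : forall k t, wf_term L t -> wf_term L (rn k t)).
  { intros k; induction t as [n|f l IH] using term_nested_ind; simpl; auto.
    change (fold_right _ True ?l) with (wf_terms L l); rewrite !wf_terms_Forall.
    intros [Ha Hl]; rewrite length_map; split; auto; apply Forall_map.
    rewrite Forall_forall in *; auto. }
  assert (Hfv : forall k t, incl (fv_term (rn k t)) (map k (fv_term t))).
  { intros k; induction t as [n|f l IH] using term_nested_ind; simpl; [apply incl_refl|].
    intros x Hx; rewrite flat_map_concat_map, map_map, <- flat_map_concat_map in Hx.
    apply in_flat_map in Hx as (t & Ht & Hx); rewrite Forall_forall in IH.
    apply IH, in_map_iff in Hx as (y & <- & Hy); auto.
    apply in_map, in_flat_map; eauto. }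
  assert (Hev : forall k P (s : nat -> dom P) t,
    teval P s (rn k t) = teval P (fun x => s (k x)) t).
  { intros k P s; induction t as [n|f l IH] using term_nested_ind; simpl; auto.
    rewrite map_map; f_equal; apply map_ext_in; rewrite Forall_forall in IH; auto. }
  induction phi as [t1 t2|r l|a IHa|a IHa b IHb|x a IHa]; simpl; intros k Hw.
  - exists (Feq (rn k t1) (rn k t2)); simpl; repeat split; try apply Hwf; try tauto.
    + rewrite map_app; apply incl_app_app; auto.
    + now rewrite !Hev.
    + now rewrite !Hev.
  - exists (Frel r (map (rn k) l)); simpl; rewrite length_map.
    repeat split; try tauto.
    + rewrite wf_terms_Forall in *; apply Forall_map; destruct Hw as [_ Hl].
      rewrite Forall_forall in *; auto.
    + intros y Hy; rewrite flat_map_concat_map, map_map, <- flat_map_concat_map in Hy.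
      apply in_flat_map in Hy as (t & Ht & Hy).
      apply Hfv, in_map_iff in Hy as (z & <- & Hz).
      apply in_map, in_flat_map; eauto.
    + rewrite map_map; intros H; erewrite map_ext; [exact H|]; intros; symmetry; apply Hev.
    + rewrite map_map; intros H; erewrite map_ext; [exact H|]; intros; apply Hev.
  - destruct (IHa k Hw) as (a' & H1 & H2 & H3); exists (Fneg a'); simpl.
    repeat split; auto; intros H; now rewrite H3 in *.
  - destruct (IHa k (proj1 Hw)) as (a' & Ha1 & Ha2 & Ha3).
    destruct (IHb k (proj2 Hw)) as (b' & Hb1 & Hb2 & Hb3).
    exists (Fand a' b'); simpl; split; [auto|split].
    + rewrite map_app; apply incl_app_app; auto.
    + intros P s; now rewrite Ha3, Hb3.
  (* The bound variable goes to one outside the images of the free variables, which avoids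
     capture. *)
  - destruct (fresh_var (map k (remove Nat.eq_dec x (fv a)))) as [z Hz].
    destruct (IHa (upd k x z) Hw) as (a' & H1 & H2 & H3).
    exists (Fex z a'); simpl; split; [auto|split].
    + apply remove_incl_cons; intros y Hy.
      apply H2, in_map_iff in Hy as (w & <- & Hw').
      destruct (Nat.eq_dec w x) as [->|Hn]; [rewrite upd_eq; now left|].
      rewrite upd_neq by auto; right; apply in_map, in_in_remove; auto.
    + intros P s; split; intros [d Hd]; exists d.
      * rewrite H3 in Hd; revert Hd; apply sat_coinc; intros y Hy; symmetry.
        destruct (Nat.eq_dec y x) as [->|Hn]; [now rewrite !upd_eq|].
        rewrite !(upd_neq _ x) by auto; apply upd_neq; intros <-.
        apply Hz, in_map, in_in_remove; auto.
      * rewrite H3; revert Hd; apply sat_coinc; intros y Hy.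
        destruct (Nat.eq_dec y x) as [->|Hn]; [now rewrite !upd_eq|].
        rewrite !(upd_neq _ x) by auto; apply upd_neq; intros <-.
        apply Hz, in_map, in_in_remove; auto.
Qed.

(** * Types of tuples and embeddings into saturated structures *)

Definition same_type (L : lang) (M N : str) (n : nat) (a : nat -> dom M) (b : nat -> dom N) :=
  forall phi, wf_form L phi -> incl (fv phi) (seq 0 n) -> (sat M a phi <-> sat N b phi).

Lemma same_type_half L M N n a b :
  (forall phi, wf_form L phi -> incl (fv phi) (seq 0 n) -> sat M a phi -> sat N b phi) ->
  same_type L M N n a b.
Proof.
  intros H phi Hw Hv; split; auto.
  intros Hn; apply NNPP; intros Hm; now apply (H (Fneg phi)) in Hm.
Qed.

(** The type of [a n] over the earlier entries, read over [b], is finitely satisfiable, because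
    quantifying variable [n] in a finite conjunction gives a formula of the common type of the two
    tuples. Saturation then realizes it. *)
Lemma same_type_step L M N n a b :
  omega_sat L N -> same_type L M N n a b ->
  exists c, same_type L M N (S n) a (upd b n c).
Proof.
  intros Hsat Hab.
  destruct (Hsat (seq 0 n) b n
    (fun phi => wf_form L phi /\ incl (fv phi) (seq 0 (S n)) /\ sat M a phi)) as [c Hc].
  - intros phi (Hw & Hv & _); split; auto; rewrite seq_S in Hv.
    intros x Hx; apply Hv, in_app_iff in Hx; simpl in *; tauto.
  - intros l Hl.
    set (conj := fold_right Fand (Feq (tvar n) (tvar n)) l).
    assert (Hconj : forall P s, sat P s conj <-> forall phi, In phi l -> sat P s phi).
    { intros P s; unfold conj; clear; induction l as [|phi l IH]; simpl.
      - split; [intros _ phi []|auto].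
      - rewrite IH; split; [intros [H1 H2] psi [<-|]; auto | auto]. }
    assert (Hw : wf_form L (Fex n conj) /\ incl (fv (Fex n conj)) (seq 0 n)).
    { simpl; rewrite remove_incl_cons; unfold conj; clear - Hl.
      induction l as [|phi l IH]; simpl.
      - split; [auto|]; intros x [<-|[<-|[]]]; now left.
      - destruct IH as [IH1 IH2]; [intros; apply Hl; now right|].
        destruct (Hl phi (or_introl eq_refl)) as (H1 & H2 & _).
        split; auto; apply incl_app; auto; rewrite seq_S in H2.
        intros x Hx; apply H2, in_app_iff in Hx; simpl in *; tauto. }
    destruct (proj1 (Hab _ (proj1 Hw) (proj2 Hw))) as [c Hc].
    + exists (a n); apply Hconj; intros phi Hp.
      destruct (Hl phi Hp) as (_ & _ & H); revert H; apply sat_coinc; intros x _.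
      destruct (Nat.eq_dec x n) as [->|]; [now rewrite upd_eq | now rewrite upd_neq].
    + exists c; now apply Hconj.
  - exists c; apply same_type_half; auto.
Qed.

(** Only the forth half of a back-and-forth is carried out, along an enumeration of [M] that may
    have repetitions. *)
Lemma countable_embedding L M N :
  countable_str M -> models_Th L M N -> omega_sat L N ->
  exists g : dom M -> dom N, elem_embedding L M N g.
Proof.
  intros [e He] HTh Hsat.
  assert (H0 : same_type L M N 0 e (fun _ => inh N)).
  { intros phi Hw Hv; apply (models_Th_iff L); auto; now apply incl_l_nil. }
  set (next := fun n (b : {b | same_type L M N n e b}) =>
    constructive_indefinite_description _
      (same_type_step L M N n e (proj1_sig b) Hsat (proj2_sig b))).
  (* Stage [n + 1] changes the assignment only at [n], so reading entry [n] at that stage gives the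
     limit [b]. *)
  set (B := nat_rect (fun n => {b | same_type L M N n e b}) (exist _ _ H0)
    (fun n b => exist (same_type L M N (S n) e) _ (proj2_sig (next n b)))).
  set (b := fun n => proj1_sig (B (S n)) n).
  assert (Hb : forall n k, k < n -> proj1_sig (B n) k = b k).
  { induction n as [|n IH]; intros k Hk; [lia|].
    destruct (Nat.eq_dec k n) as [->|Hn]; [reflexivity|].
    rewrite <- IH by lia; simpl; now apply upd_neq. }
  assert (Htype : forall n, same_type L M N n e b).
  { intros n phi Hw Hv; rewrite (proj2_sig (B n) phi Hw Hv).
    apply sat_coinc; intros x Hx; apply Hb; apply Hv, in_seq in Hx; lia. }
  set (k := fun d => proj1_sig (constructive_indefinite_description _ (He d))).
  exists (fun d => b (k d)); intros phi s Hw.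
  (* Renaming each variable [x] to the index of [s x] turns a statement about [s] into one about the
     enumeration. *)
  destruct (form_rename L phi (fun x => k (s x)) Hw) as (psi & Hw' & _ & Hpsi).
  destruct (seq_bound (fv psi)) as (n & _ & Hn).
  rewrite <- (Hpsi N b), <- (Htype n psi Hw' Hn), (Hpsi M e).
  apply sat_coinc; intros x _; unfold k; now destruct constructive_indefinite_description.
Qed.

(** * Coding a set of tuples into a symbol *)

Lemma wf_term_mono L1 L2 t :
  (forall j m, fun_ar L1 j = Some m -> fun_ar L2 j = Some m) -> wf_term L1 t -> wf_term L2 t.
Proof.
  intros H; induction t as [n|f l IH] using term_nested_ind; simpl; auto.
  change (fun_ar L1 f = Some (length l) /\ wf_terms L1 l ->
          fun_ar L2 f = Some (length l) /\ wf_terms L2 l).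
  rewrite !wf_terms_Forall, !Forall_forall; rewrite Forall_forall in IH.
  intros [Ha Hl]; split; auto.
Qed.

Lemma wf_form_mono L1 L2 phi : lang_ext L1 L2 -> wf_form L1 phi -> wf_form L2 phi.
Proof.
  intros [Hf Hr].
  induction phi as [t1 t2|r l|a IHa|a IHa b IHb|x a IHa]; simpl; try tauto.
  - intros [? ?]; split; eapply wf_term_mono; eauto.
  - rewrite !wf_terms_Forall, !Forall_forall; intros [Ha Hl]; split; auto.
    intros t Ht; eapply wf_term_mono; eauto.
Qed.

Definition ar (isf : bool) (L : lang) : nat -> option nat :=
  if isf then fun_ar L else rel_ar L.

Definition with_arity (isf : bool) (i a : nat) (L : lang) : lang :=
  if isf then Lang (set_ar (fun_ar L) i a) (rel_ar L)
  else Lang (fun_ar L) (set_ar (rel_ar L) i a).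

Lemma recursive_with_arity isf i a L :
  recursive_lang L -> recursive_lang (with_arity isf i a L).
Proof.
  intros [Hf Hr]; destruct isf; split; simpl; auto; now apply recursive_set_ar.
Qed.

Lemma lang_ext_with_arity isf i a L Lp :
  lang_ext L Lp -> ar isf L i = None -> lang_ext L (with_arity isf i a Lp).
Proof.
  intros [Hf Hr] Hi; destruct isf; split; simpl in *; auto; intros j m Hj;
    unfold set_ar; destruct (Nat.eqb_spec j i) as [->|]; auto; congruence.
Qed.

Lemma ar_with_arity isf i a L : ar isf (with_arity isf i a L) i = Some a.
Proof. destruct isf; simpl; unfold set_ar; now rewrite Nat.eqb_refl. Qed.

(** * Well-formedness and truth of translated formulas *)

Section Translation.

Variables (isf : bool) (i K k0 : nat).

Lemma fun_ar_pad Lp j m : ar isf Lp i = Some k0 -> fun_ar Lp j = Some m ->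
  fun_ar (with_arity isf i (K + k0) Lp) j = Some (padf isf i K j + m).
Proof.
  unfold padf; intros Hi Hj; destruct isf; cbn -[Nat.add] in *; auto; unfold set_ar.
  destruct (Nat.eqb_spec j i) as [->|]; auto.
  rewrite Hi in Hj; now injection Hj as ->.
Qed.

Lemma rel_ar_pad Lp j m : ar isf Lp i = Some k0 -> rel_ar Lp j = Some m ->
  rel_ar (with_arity isf i (K + k0) Lp) j = Some (padr isf i K j + m).
Proof.
  unfold padr; intros Hi Hj; destruct isf; cbn -[Nat.add] in *; auto; unfold set_ar.
  destruct (Nat.eqb_spec j i) as [->|]; auto.
  rewrite Hi in Hj; now injection Hj as ->.
Qed.

Lemma wf_tr_args Lp k l : Forall (fun t => wf_term Lp (tr_term isf i K t)) l ->
  wf_terms Lp (repeat (tvar 0) k ++ map (tr_term isf i K) l).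
Proof.
  intros H; apply wf_terms_Forall, Forall_app; split.
  - apply Forall_forall; intros t Ht; apply repeat_spec in Ht as ->; exact I.
  - now apply Forall_map.
Qed.

Lemma wf_tr_term Lp t : ar isf Lp i = Some k0 -> wf_term Lp t ->
  wf_term (with_arity isf i (K + k0) Lp) (tr_term isf i K t).
Proof.
  intros Hi; induction t as [m|f l IH] using term_nested_ind; simpl; auto.
  change (fold_right _ True l) with (wf_terms Lp l).
  rewrite wf_terms_Forall; intros [Ha Hl]; split.
  - rewrite length_app, repeat_length, length_map; now apply fun_ar_pad.
  - apply wf_tr_args; rewrite Forall_forall in *; auto.
Qed.

Lemma wf_tr Lp phi : ar isf Lp i = Some k0 -> wf_form Lp phi ->
  wf_form (with_arity isf i (K + k0) Lp) (tr isf i K phi).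
Proof.
  intros Hi; induction phi as [t1 t2|r l|a IHa|a IHa b IHb|x a IHa]; simpl; try tauto.
  - intros []; split; now apply wf_tr_term.
  - rewrite wf_terms_Forall; intros [Ha Hl]; split.
    + rewrite length_app, repeat_length, length_map; now apply rel_ar_pad.
    + apply wf_tr_args; rewrite Forall_forall in *; intros; apply wf_tr_term; auto.
Qed.

Lemma fv_tr_args k l :
  Forall (fun t => incl (fv_term (tr_term isf i K t)) (0 :: fv_term t)) l ->
  incl (flat_map fv_term (repeat (tvar 0) k ++ map (tr_term isf i K) l))
       (0 :: flat_map fv_term l).
Proof.
  intros H x Hx; apply in_flat_map in Hx as (t & Ht & Hx).
  apply in_app_iff in Ht as [Ht|Ht].
  - apply repeat_spec in Ht as ->; destruct Hx as [<-|[]]; now left.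
  - apply in_map_iff in Ht as (u & <- & Hu); rewrite Forall_forall in H.
    destruct (H u Hu x Hx) as [<-|]; [now left|]; right; apply in_flat_map; eauto.
Qed.

Lemma fv_tr_term t : incl (fv_term (tr_term isf i K t)) (0 :: fv_term t).
Proof.
  induction t as [m|f l IH] using term_nested_ind; [apply incl_tl, incl_refl|].
  now apply fv_tr_args.
Qed.

Lemma fv_tr phi : incl (fv (tr isf i K phi)) (0 :: fv phi).
Proof.
  induction phi as [t1 t2|r l|a IHa|a IHa b IHb|x a IHa]; simpl; auto.
  - pose proof (fv_tr_term t1) as H1; pose proof (fv_tr_term t2) as H2; intros x Hx.
    apply in_app_iff in Hx as [Hx|Hx]; [apply H1 in Hx | apply H2 in Hx];
      simpl in *; rewrite in_app_iff; tauto.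
  - apply fv_tr_args, Forall_forall; intros; apply fv_tr_term.
  - intros x Hx; apply in_app_iff in Hx as [Hx|Hx]; [apply IHa in Hx | apply IHb in Hx];
      simpl in *; rewrite in_app_iff; tauto.
  - apply remove_incl_cons; intros y Hy; apply IHa in Hy.
    destruct (Nat.eq_dec y x) as [->|Hn]; [now left|]; right.
    destruct Hy as [<-|Hy]; [now left|]; right; apply in_in_remove; auto.
Qed.

(** The pads are evaluated at the current value of variable 0, which quantifiers may change. Hence
    the hypotheses speak about every pad value [e]. *)
Lemma sat_tr Lp N f r f2 r2 :
  (forall j l e, fun_ar Lp j = Some (length l) ->
     f j (repeat e (padf isf i K j) ++ l) = f2 j l) ->
  (forall j l e, rel_ar Lp j = Some (length l) ->
     (r j (repeat e (padr isf i K j) ++ l) <-> r2 j l)) ->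
  forall phi s, wf_form Lp phi ->
    (sat (expand N f r) s (tr isf i K phi) <-> sat (expand N f2 r2) s phi).
Proof.
  intros Hf Hr.
  assert (Ht : forall s t, wf_term Lp t -> teval (expand N f r) s (tr_term isf i K t)
                                         = teval (expand N f2 r2) s t).
  { intros s t; induction t as [m|g l IH] using term_nested_ind; simpl; auto.
    change (fold_right _ True l) with (wf_terms Lp l).
    rewrite wf_terms_Forall; intros [Ha Hl].
    rewrite map_app, map_repeat, map_map, <- Hf with (e := s 0) by now rewrite length_map.
    f_equal; f_equal; apply map_ext_in; rewrite Forall_forall in *; auto. }
  induction phi as [t1 t2|g l|a IHa|a IHa b IHb|x a IHa]; simpl; intros s Hw.
  - rewrite !Ht; tauto.
  - destruct Hw as [Ha Hl]; rewrite wf_terms_Forall, Forall_forall in Hl.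
    rewrite map_app, map_repeat, map_map, <- Hr with (e := s 0) by now rewrite length_map.
    erewrite (map_ext_in _ (teval (expand N f2 r2) s)); [reflexivity|]; auto.
  - now rewrite IHa.
  - rewrite IHa, IHb; tauto.
  - split; intros [d Hd]; exists d; now apply IHa.
Qed.

Lemma sat_stamp P s phi : sat P s (stamp isf i K phi) <-> sat P s (tr isf i K phi).
Proof. unfold stamp; simpl; split; [tauto|]; intros H; split; [auto|now exists (s 0)]. Qed.

Lemma wf_stamp L phi : wf_form L (tr isf i K phi) -> wf_form L (stamp isf i K phi).
Proof. unfold stamp; simpl; auto. Qed.

Lemma fv_stamp phi : incl (fv (stamp isf i K phi)) (0 :: fv phi).
Proof.
  unfold stamp; cbn [fv fv_term app]; apply incl_app; [apply fv_tr|].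
  apply remove_incl_cons; intros x [<-|[<-|[]]]; now left.
Qed.

End Translation.

(** * Formulas that read and constrain the enlarged symbol *)

Section Coding.

Variables (isf : bool) (i n k0 : nat).
(** Two places for marks and [n] places for a tuple. *)
Local Notation K := (S (S n)).

(** Functions are treated through their graphs, so that both kinds of symbol share the later
    formulas; [v] stands for the value of a function symbol. *)
Definition atom (ks : list nat) (v : nat) : form :=
  if isf then Feq (tapp i (map tvar ks)) (tvar v) else Frel i (map tvar ks).

Definition holds (P : str) (l : list (dom P)) (v : dom P) : Prop :=
  if isf then fn P i l = v else rl P i l.

Lemma sat_atom P s ks v : sat P s (atom ks v) <-> holds P (map s ks) (s v).
Proof.
  unfold atom, holds; destruct isf; simpl; now rewrite map_map.
Qed.

Lemma wf_atom L ks v : ar isf L i = Some (length ks) -> wf_form L (atom ks v).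
Proof.
  assert (H : wf_terms L (map tvar ks)) by (induction ks; simpl; auto).
  unfold atom; destruct isf; simpl; rewrite length_map; auto.
Qed.

Lemma fv_atom ks v : incl (fv (atom ks v)) (v :: ks).
Proof.
  assert (H : flat_map fv_term (map tvar ks) = ks)
    by (induction ks as [|k ks IH]; simpl; congruence).
  unfold atom; destruct isf; simpl; rewrite H; [|apply incl_tl, incl_refl].
  intros x; rewrite in_app_iff; simpl; tauto.
Qed.

(* The tuples [v_0 .. v_(n-1)] selected by the enlarged symbol: pads [u, w] with [u <> w]
   announce that it speaks about them rather than about the original symbol. *)
Definition marked : form :=
  Fex n (Fex (S n) (Fand (Fneg (Feq (tvar n) (tvar (S n))))
    (atom (n :: S n :: seq 0 n ++ repeat n k0) n))).

Lemma sat_marked P s : sat P s marked <->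
  exists u w, u <> w /\ holds P (u :: w :: map s (seq 0 n) ++ repeat u k0) u.
Proof.
  assert (E : forall u w, let s' := upd (upd s n u) (S n) w in
    s' n = u /\ s' (S n) = w /\
    map s' (n :: S n :: seq 0 n ++ repeat n k0) =
    u :: w :: map s (seq 0 n) ++ repeat u k0).
  { intros u w s'.
    assert (H1 : s' n = u) by (unfold s'; rewrite upd_neq by lia; apply upd_eq).
    assert (H2 : s' (S n) = w) by apply upd_eq.
    repeat split; auto; simpl; rewrite map_app, map_repeat, H1, H2.
    do 3 f_equal; apply map_ext_in; intros x Hx; apply in_seq in Hx.
    unfold s'; rewrite !upd_neq by lia; auto. }
  unfold marked; cbn [sat teval].
  split; intros (u & w & H); exists u, w; destruct (E u w) as (H1 & H2 & H3);
    rewrite sat_atom, H1, H2, H3 in *; auto.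
Qed.

Lemma wf_marked L : ar isf L i = Some (K + k0) -> wf_form L marked.
Proof.
  intros H; simpl; split; [auto|]; apply wf_atom.
  rewrite H; f_equal; simpl; rewrite length_app, length_seq, repeat_length; lia.
Qed.

Lemma fv_marked : incl (fv marked) (seq 0 n).
Proof.
  unfold marked; cbn [fv]; rewrite !remove_incl_cons; apply incl_app.
  - intros x [<-|[<-|[]]]; simpl; auto.
  - intros x Hx; apply fv_atom in Hx; simpl in *; rewrite in_app_iff in Hx.
    destruct Hx as [|[|[|[|Hx]]]]; auto; apply repeat_spec in Hx; auto.
Qed.

(** Variables below [k0] are the original arguments, [k0] and [k0 + 1] two pad values, and [k0 + 2]
    the value of a function symbol. In an expansion of [M] this sentence ensures that equal pads
    define one interpretation of the original symbol. *)
Definition pads_irrelevant : form :=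
  Fneg (exs (seq 0 (k0 + 3))
    (Fand (atom (repeat k0 K ++ seq 0 k0) (S (S k0)))
          (Fneg (atom (repeat (S k0) K ++ seq 0 k0) (S (S k0)))))).

Lemma fv_pads : incl
  (fv (Fand (atom (repeat k0 K ++ seq 0 k0) (S (S k0)))
            (Fneg (atom (repeat (S k0) K ++ seq 0 k0) (S (S k0)))))) (seq 0 (k0 + 3)).
Proof.
  cbn [fv]; apply incl_app; intros x Hx; apply fv_atom in Hx as [<-|Hx];
    try (apply in_app_iff in Hx as [Hx|Hx]; [apply repeat_spec in Hx|apply in_seq in Hx]);
    apply in_seq; lia.
Qed.

Lemma fv_pads_irrelevant : fv pads_irrelevant = [].
Proof. apply fv_exs_closed, fv_pads. Qed.

Lemma wf_pads_irrelevant L : ar isf L i = Some (K + k0) -> wf_form L pads_irrelevant.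
Proof.
  intros H; apply wf_exs; split; apply wf_atom;
    now rewrite length_app, length_seq, repeat_length.
Qed.

Lemma sat_pads_irrelevant P s : sat P s pads_irrelevant <->
  forall l d e v, length l = k0 ->
    holds P (repeat d K ++ l) v -> holds P (repeat e K ++ l) v.
Proof.
  unfold pads_irrelevant; cbn [sat]; rewrite sat_exs by apply fv_pads; split.
  - intros H l d e v Hl Hd; apply NNPP; intros He; apply H.
    set (s' := fun j => nth j (l ++ [d; e; v]) d); exists s'; cbn [sat].
    assert (E : map s' (seq 0 k0) = l).
    { subst k0; rewrite <- (firstn_all l) at 2.
      apply nth_ext with d d; rewrite length_map, length_seq, ?firstn_all; auto.
      intros x Hx; rewrite nth_indep with (d' := s' 0) by now rewrite length_map, length_seq.
      rewrite map_nth, seq_nth by auto; unfold s'; simpl; now apply app_nth1. }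
    assert (Hs : s' k0 = d /\ s' (S k0) = e /\ s' (S (S k0)) = v).
    { subst k0; unfold s'; repeat split; rewrite app_nth2 by lia.
      - now rewrite Nat.sub_diag.
      - now replace (S (length l) - length l) with 1 by lia.
      - now replace (S (S (length l)) - length l) with 2 by lia. }
    destruct Hs as (H1 & H2 & H3).
    rewrite !sat_atom, !map_app, !map_repeat, E, H1, H2, H3; auto.
  - intros H [s' [H1 H2]]; apply H2; cbn [sat] in *.
    rewrite !sat_atom, !map_app, !map_repeat in *.
    revert H1; apply H; now rewrite length_map, length_seq.
Qed.

(** * The structure that marks a given tuple *)

Section CodeTuple.

Variables (N : str) (b : list (dom N)).

(** Equal marks give back the original symbol on the arguments after the pads. A function symbol has
    no truth value to return, so for distinct marks [u] means yes and [w] means no. *)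
Definition code_fn (j : nat) (l : list (dom N)) : dom N :=
  if isf && (j =? i) then
    match l with
    | u :: w :: l =>
        if excluded_middle_informative (u = w) then fn N j (skipn n l)
        else if excluded_middle_informative (firstn n l = b) then u else w
    | _ => inh N
    end
  else fn N j l.

Definition code_rl (j : nat) (l : list (dom N)) : Prop :=
  if negb isf && (j =? i) then
    match l with
    | u :: w :: l => (u = w /\ rl N j (skipn n l)) \/ (u <> w /\ firstn n l = b)
    | _ => False
    end
  else rl N j l.

Lemma skipn_repeat_app (e : dom N) l : skipn n (repeat e n ++ l) = l.
Proof.
  rewrite skipn_app, skipn_all2, repeat_length, Nat.sub_diag by now rewrite repeat_length.
  reflexivity.
Qed.

Lemma code_fn_pad j l e : code_fn j (repeat e (padf isf i K j) ++ l) = fn N j l.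
Proof.
  unfold code_fn, padf; destruct (isf && (j =? i)); [|reflexivity].
  simpl; destruct excluded_middle_informative; [|easy].
  now rewrite skipn_repeat_app.
Qed.

Lemma code_rl_pad j l e : code_rl j (repeat e (padr isf i K j) ++ l) <-> rl N j l.
Proof.
  unfold code_rl, padr; destruct (negb isf && (j =? i)); [|reflexivity].
  simpl; rewrite skipn_repeat_app; tauto.
Qed.

Lemma holds_code_pad l e v :
  holds (expand N code_fn code_rl) (repeat e K ++ l) v <-> holds N l v.
Proof.
  pose proof (code_fn_pad i l e) as Hf; pose proof (code_rl_pad i l e) as Hr.
  unfold padf, padr in *; rewrite Nat.eqb_refl, andb_true_r in *.
  unfold holds; destruct isf; simpl in *; [now rewrite Hf | exact Hr].
Qed.

Lemma holds_code_mark (l m : list (dom N)) (u w : dom N) : length l = n -> u <> w ->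
  (holds (expand N code_fn code_rl) (u :: w :: l ++ m) u <-> l = b).
Proof.
  intros Hl Hn; unfold holds; simpl; unfold code_fn, code_rl; rewrite Nat.eqb_refl.
  assert (E : firstn n (l ++ m) = l)
    by (rewrite <- Hl, firstn_app, Nat.sub_diag, firstn_all; simpl; now rewrite app_nil_r).
  destruct isf; simpl; rewrite E; [|tauto].
  destruct excluded_middle_informative; [easy|].
  destruct excluded_middle_informative; intuition congruence.
Qed.

Lemma sat_code L phi s : ar isf L i = None -> wf_form L phi ->
  (sat (expand N code_fn code_rl) s phi <-> sat N s phi).
Proof.
  intros Hi Hw; apply (sat_iso L (expand N code_fn code_rl) N (fun d => d)); auto.
  split; [eauto|split; [auto|split]]; intros j l Hj; rewrite map_id; simpl;
    unfold code_fn, code_rl; destruct (Nat.eqb_spec j i) as [->|];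
    rewrite ?andb_false_r, ?andb_true_r; try reflexivity;
    destruct isf; try reflexivity; simpl in Hi; congruence.
Qed.

End CodeTuple.

End Coding.

Lemma sat_expand_self N s phi : sat (expand N (fn N) (rl N)) s phi <-> sat N s phi.
Proof. now destruct N. Qed.

(** * Types of tuples determine their types in the expanded language *)

(** Transporting the expansion along [g] gives another expansion of [M], because [g] is an
    [L]-automorphism; being isomorphic to the first, it satisfies [T] and omits [p]. Categoricity
    identifies the two. *)
Lemma categorical_automorphism L Lp M T p f r g :
  theory Lp T -> is_type Lp p -> categorical_over L Lp M T p ->
  is_expansion L M f r -> models (expand M f r) T -> omits (expand M f r) p ->
  automorphism L M g ->
  forall phi s, wf_form Lp phi ->
    (sat (expand M f r) s phi <-> sat (expand M f r) (fun x => g (s x)) phi).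
Proof.
  intros HT [xs Hp] Hcat [Hf Hr] HmT Homit [[h [Hhg Hgh]] [Hgf Hgr]] phi s Hw.
  set (f' := fun j l => g (f j (map h l))); set (r' := fun j l => r j (map h l)).
  assert (Ehg : forall l, map h (map g l) = l)
    by (intros l; rewrite map_map, <- map_id; now apply map_ext).
  assert (Egh : forall l, map g (map h l) = l)
    by (intros l; rewrite map_map, <- map_id; now apply map_ext).
  assert (Hiso : isomorphism Lp (expand M f r) (expand M f' r') g).
  { split; [eauto|split; [|split]].
    - intros c c' E; rewrite <- (Hhg c), E; apply Hhg.
    - intros j l _; simpl; unfold f'; now rewrite Ehg.
    - intros j l _; simpl; unfold r'; now rewrite Ehg. }
  rewrite (sat_iso Lp (expand M f r) (expand M f' r') g phi Hiso Hw s (fun x => g (s x))) by auto.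
  apply sat_same_interp with Lp; auto; apply Hcat; try (split; assumption); auto.
  - split; intros j m Hj l Hl; unfold f', r'.
    + rewrite (Hf j m) by (auto; now rewrite length_map).
      rewrite (Hgf j m), Egh by (auto; now rewrite length_map); reflexivity.
    + rewrite (Hr j m) by (auto; now rewrite length_map).
      rewrite (Hgr j m), Egh by (auto; now rewrite length_map); reflexivity.
  - intros psi Hpsi; destruct (HT psi Hpsi) as [Hwp Hvp].
    apply (sat_iso Lp (expand M f r) (expand M f' r') g psi Hiso Hwp (fun _ => inh M)).
    + now rewrite Hvp.
    + now apply HmT.
  - intros t; destruct (Homit (fun x => h (t x))) as (psi & Hpsi & Hn).
    exists psi; split; auto.
    rewrite <- (sat_iso Lp (expand M f r) (expand M f' r') g psi Hiso
      (proj1 (Hp psi Hpsi)) (fun x => h (t x))); auto.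
Qed.

Section Determined.

Variables (L : lang) (M : str) (X : (nat -> Prop) -> Prop).
Hypotheses (HX : scott_set X) (Htr : transcendent_wit L M X).

(** Saturation is applied, with no parameters, to a complete type that [a] realizes. *)
Lemma type_coded n (a : nat -> dom M) :
  X (codeset (fun phi => wf_form L phi /\ incl (fv phi) (seq 0 n) /\ sat M a phi)).
Proof.
  destruct Htr as (_ & Hsat & _).
  apply (Hsat (seq 0 n) [] a); rewrite ?app_nil_r; [apply seq_NoDup| |].
  - split; [|split]; rewrite ?app_nil_r.
    + tauto.
    + intros l Hl; exists a; split; auto; intros phi Hp; apply Hl, Hp.
    + intros phi Hw Hv; destruct (classic (sat M a phi)); [left|right]; auto.
  - exists a; split; [auto|tauto].
Qed.

Variables (Lp : lang) (T p : form -> Prop).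
Hypotheses (Hext : recursive_ext L Lp) (HT : theory Lp T) (XT : X (codeset T))
  (Hp : is_type Lp p) (Xp : X (codeset p)) (Hcat : categorical_over L Lp M T p).

Variables (f : nat -> list (dom M) -> dom M) (r : nat -> list (dom M) -> Prop).
Hypotheses (Hexp : is_expansion L M f r) (HMT : models (expand M f r) T)
  (HMp : omits (expand M f r) p).

Variable N : str.
Hypotheses (HN : models_Th L M N) (HNT : models N T) (HNp : omits N p)
  (HNsat : omega_sat L N).

(** The sentence is added to [T]. The structure [N] witnesses [con_sat] for the enlarged theory, and
    categoricity identifies the resulting expansion with the given one. *)
Lemma sentence_transfer sigma :
  sentence Lp sigma -> satS N sigma -> satS (expand M f r) sigma.
Proof.
  intros Hs HNs; destruct Htr as (_ & _ & Hplus).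
  destruct (Hplus Lp (fun phi => T phi \/ phi = sigma) p) as (f' & r' & H1 & H2 & H3); auto.
  - intros phi [| ->]; auto.
  - apply scott_union; auto; now apply scott_single.
  - exists N; repeat split; auto; intros phi [| ->]; auto.
  - apply (sat_same_interp Lp M f r f' r').
    + apply Hcat; auto; intros phi Hphi; apply H2; auto.
    + apply Hs.
    + apply H2; auto.
Qed.

(** Here [M] has no two distinct elements to serve as marks. All assignments into [M] agree, so a
    failure of [phi] can be transferred by a sentence that does not mention the type. *)
Lemma determined_singleton n a b phi :
  (forall d e : dom M, d = e) -> wf_form Lp phi -> incl (fv phi) (seq 0 n) ->
  sat (expand M f r) a phi -> sat N b phi.
Proof.
  intros Hone Hw Hv Ha; apply NNPP; intros Hb.
  assert (H : satS (expand M f r) (exs (seq 0 n) (Fneg phi))).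
  { apply sentence_transfer.
    - split; [now apply wf_exs | now apply fv_exs_closed].
    - apply sat_exs; auto; now exists b. }
  apply sat_exs in H as [s Hs]; auto; apply Hs; revert Ha.
  apply sat_coinc; auto.
Qed.

Lemma determined_coded isf i k0 n a b phi (d1 d2 : dom M) :
  ar isf L i = None -> ar isf Lp i = Some k0 -> d1 <> d2 -> 0 < n ->
  same_type L M N n a b -> wf_form Lp phi -> incl (fv phi) (seq 0 n) ->
  sat (expand M f r) a phi -> sat N b phi.
Proof.
  intros HLi HLpi Hd Hn Hab Hw Hv Ha; apply NNPP; intros Hb.
  set (K := S (S n)); set (Lp' := with_arity isf i (K + k0) Lp).
  set (Q := marked isf i n k0).
  set (tp := fun psi => wf_form L psi /\ incl (fv psi) (seq 0 n) /\ sat M a psi).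
  (* Taken over the type of [a] and joined with [sigma1] and [sigma2], this says that marked tuples
     exist, all realize the type of [a], and none satisfies [phi]. The sentence [sigma3] keeps the
     original symbol recoverable. *)
  set (univ := fun psi => Fneg (exs (seq 0 n) (Fand Q (Fneg psi)))).
  set (sigma1 := exs (seq 0 n) Q).
  set (sigma2 := Fneg (exs (seq 0 n) (Fand Q (tr isf i K phi)))).
  set (sigma3 := pads_irrelevant isf i n k0).
  (* The stamped sentences of [T] are closed by [Fex 0], because padding may have freed variable
     0. *)
  set (T' := fun psi => image (Fex 0) (image (stamp isf i K) T) psi \/
    (image univ tp psi \/ (psi = sigma1 \/ (psi = sigma2 \/ psi = sigma3)))).
  set (p' := image (stamp isf i K) p).
  destruct Hext as [Hrec HLLp].
  assert (Hext' : recursive_ext L Lp').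
  { split; [now apply recursive_with_arity | now apply lang_ext_with_arity]. }
  assert (Har : ar isf Lp' i = Some (K + k0)) by apply ar_with_arity.
  assert (HwQ : wf_form Lp' Q) by now apply wf_marked.
  assert (HvQ : incl (fv Q) (seq 0 n)) by apply fv_marked.
  assert (Hvtr : incl (fv (tr isf i K phi)) (seq 0 n)).
  { intros x Hx; apply fv_tr in Hx as [<-|Hx]; [apply in_seq; lia | auto]. }
  assert (HT' : theory Lp' T').
  { intros psi [(? & (chi0 & Hc & ->) & ->)|[(chi0 & (Hcw & Hcv & _) & ->)|[->|[->| ->]]]].
    - destruct (HT chi0 Hc) as [Hcw Hcv]; split.
      + apply wf_stamp; now apply wf_tr.
      + apply incl_l_nil; cbn [fv]; apply remove_incl_cons.
        rewrite <- Hcv; apply fv_stamp.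
    - split.
      + apply wf_exs; split; auto; apply wf_form_mono with L; auto; apply Hext'.
      + apply fv_exs_closed; now apply incl_app.
    - split; [now apply wf_exs | now apply fv_exs_closed].
    - split; [apply wf_exs; split; auto; now apply wf_tr|].
      apply fv_exs_closed; now apply incl_app.
    - split; [now apply wf_pads_irrelevant | apply fv_pads_irrelevant]. }
  assert (XT' : X (codeset T')).
  { unfold T'; repeat (apply scott_union; [exact HX| |]);
      try (now apply scott_single).
    - now apply scott_image_ex, scott_image_stamp.
    - apply (scott_image_comp X HX Fneg), scott_image_neg; auto.
      apply (scott_image_comp X HX (exs (seq 0 n))), scott_image_exs; auto.
      apply (scott_image_comp X HX (Fand Q) Fneg), scott_image_and; auto.
      apply scott_image_neg; auto; apply type_coded. }
  assert (Hp' : is_type Lp' p').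
  { destruct Hp as [xs Hxs]; exists (0 :: xs); intros psi (chi0 & Hc & ->).
    destruct (Hxs chi0 Hc) as [Hcw Hcv]; split.
    - apply wf_stamp; now apply wf_tr.
    - intros x Hx; apply fv_stamp in Hx as [<-|Hx]; [now left | right; auto]. }
  assert (Xp' : X (codeset p')) by now apply scott_image_stamp.
  assert (Hcon : con_sat L M T' p').
  { set (bs := map b (seq 0 n)).
    (* In [N'] the marked tuple is [b] alone, where [phi] fails. Truth of [L]-formulas is as in [N],
       which preserves saturation. *)
    set (N' := expand N (code_fn isf i n N bs) (code_rl isf i n N bs)).
    exists N'.
    assert (HL : forall psi s, wf_form L psi -> (sat N' s psi <-> sat N s psi))
      by (intros; now apply sat_code with L).
    assert (Htrans : forall psi s, wf_form Lp psi ->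
      (sat N' s (tr isf i K psi) <-> sat N s psi)).
    { intros psi s Hwp; rewrite <- (sat_expand_self N).
      apply sat_tr with Lp; auto; intros; [apply code_fn_pad | apply code_rl_pad]. }
    assert (HQ : forall s, sat N' s Q -> forall x, In x (seq 0 n) -> s x = b x).
    { intros s Hs; apply sat_marked in Hs as (u & w & Hne & H).
      apply (holds_code_mark isf i n N bs (map s (seq 0 n)) (repeat u k0)) in H; auto;
        [|now rewrite length_map, length_seq].
      now apply map_ext_in_iff. }
    split; [|split; [|split]].
    - intros psi [Hwp Hvp] Hs; apply HL; auto; now apply HN.
    - intros psi [(? & (chi0 & Hc & ->) & ->)
                 |[(chi0 & (Hcw & Hcv & Hca) & ->)|[->|[->| ->]]]].
      + exists (inh N); apply sat_stamp, Htrans; [now apply HT|].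
        apply (sat_sentence N (fun _ => inh N)); [now apply HT | now apply HNT].
      + unfold satS, univ; cbn [sat]; rewrite sat_exs by now apply incl_app.
        intros (s & Hs & Hns); apply Hns, HL; auto.
        apply Hab in Hca; auto; revert Hca; apply sat_coinc.
        intros x Hx; apply (HQ s); auto.
      + apply sat_exs; auto; exists b; apply sat_marked.
        (* Two distinct marks exist in [N] because [d1] and [d2] make a sentence of [L] true in
           [M]. *)
        assert (Hex : satS N (Fex 0 (Fex 1 (Fneg (Feq (tvar 0) (tvar 1)))))).
        { apply HN; [now repeat split|]; now exists d1, d2. }
        destruct Hex as (u & w & Hne); exists u, w; split; auto.
        apply (holds_code_mark isf i n N bs bs (repeat u k0)); auto;
          unfold bs; now rewrite length_map, length_seq.
      + unfold satS, sigma2; cbn [sat]; rewrite sat_exs by now apply incl_app.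
        intros (s & Hs & Htrs); apply Hb; apply Htrans in Htrs; auto; revert Htrs.
        apply sat_coinc; intros x Hx; symmetry; apply (HQ s); auto.
      + apply sat_pads_irrelevant; intros l d e v _ H.
        apply (holds_code_pad isf i n N bs) in H.
        now apply (holds_code_pad isf i n N bs).
    - intros s; destruct (HNp s) as (psi & Hpsi & Hns).
      exists (stamp isf i K psi); split; [now exists psi|].
      rewrite sat_stamp, Htrans; auto; destruct Hp as [xs Hxs]; now apply Hxs.
    - intros xs c x q Hq Hfin; destruct (HNsat xs c x q Hq) as [e He].
      + intros l Hl; destruct (Hfin l Hl) as [e He]; exists e; intros psi Hpsi.
        apply HL; [now apply Hq, Hl | now apply He].
      + exists e; intros psi Hpsi; apply HL; [now apply Hq | now apply He]. }
  destruct Htr as (Hhom & _ & Hplus).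
  destruct (Hplus Lp' T' p') as (f' & r' & Hexp' & HmT' & Homit'); auto.
  (* Filling the extra places with equal pads reads an interpretation of [Lp] off the new expansion;
     by [Hirr] any element could replace [inh M]. *)
  set (f2 := fun j l => f' j (repeat (inh M) (padf isf i K j) ++ l)).
  set (r2 := fun j l => r' j (repeat (inh M) (padr isf i K j) ++ l)).
  assert (Hirr : forall l d e v, length l = k0 ->
    holds isf i (expand M f' r') (repeat d K ++ l) v ->
    holds isf i (expand M f' r') (repeat e K ++ l) v).
  { apply (sat_pads_irrelevant isf i n k0 (expand M f' r') (fun _ => inh M)).
    apply HmT'; unfold T'; tauto. }
  assert (Htrans : forall psi s, wf_form Lp psi ->
    (sat (expand M f' r') s (tr isf i K psi) <-> sat (expand M f2 r2) s psi)).
  { intros psi s; apply sat_tr; intros j l e Hj; unfold f2, r2, padf, padr.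
    - destruct (Nat.eqb_spec j i) as [->|]; [|now rewrite andb_false_r].
      rewrite andb_true_r; destruct isf; [|reflexivity].
      simpl in HLpi; rewrite HLpi in Hj; injection Hj as Hj.
      now apply (Hirr l (inh M) e).
    - destruct (Nat.eqb_spec j i) as [->|]; [|now rewrite andb_false_r].
      rewrite andb_true_r; destruct isf; [reflexivity|].
      simpl in HLpi; rewrite HLpi in Hj; injection Hj as Hj.
      split; now apply (fun d e => Hirr l d e (inh M)). }
  (* The interpretation read off expands [M], satisfies [T] and omits [p], so categoricity makes it
     the given one. *)
  assert (Hsame : same_interp Lp f f2 r r2).
  { apply Hcat; auto.
    - destruct Hexp' as [Hf Hr]; split; intros j m Hj l Hl; unfold f2, r2, padf, padr.
      + destruct (Nat.eqb_spec j i) as [->|]; [|rewrite andb_false_r; eauto].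
        destruct isf; simpl in *; [congruence | eauto].
      + destruct (Nat.eqb_spec j i) as [->|]; [|rewrite andb_false_r; eauto].
        destruct isf; simpl in *; [eauto | congruence].
    - intros psi Hpsi; destruct (HT psi Hpsi) as [Hwp Hvp].
      assert (H : satS (expand M f' r') (Fex 0 (stamp isf i K psi))).
      { apply HmT'; left; eexists; split; [now exists psi | reflexivity]. }
      destruct H as [d H]; apply sat_stamp, Htrans in H; auto.
      revert H; now apply sat_sentence.
    - intros s; destruct (Homit' s) as (? & (psi & Hpsi & ->) & Hns).
      exists psi; split; auto; destruct Hp as [xs Hxs].
      rewrite <- Htrans by (now apply Hxs); now rewrite <- sat_stamp. }
  assert (H1 : satS (expand M f' r') sigma1) by (apply HmT'; unfold T'; tauto).
  apply sat_exs in H1 as [a' Ha']; auto.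
  assert (Haa : same_type L M M n a a').
  { apply same_type_half; intros psi Hwp Hvp Hpsi.
    assert (H : satS (expand M f' r') (univ psi)).
    { apply HmT'; right; left; now exists psi. }
    unfold satS, univ in H; cbn [sat] in H; rewrite sat_exs in H by now apply incl_app.
    apply (sat_expansion L M f' r'); auto; apply NNPP; intros Hns; apply H.
    now exists a'. }
  (* Homogeneity carries [a] to the marked tuple [a']. The automorphism preserves the given
     expansion, so [phi] holds at [a'], against [sigma2]. *)
  destruct (Hhom n a a' Haa) as (g & Hg & Hgaa).
  assert (H2 : satS (expand M f' r') sigma2) by (apply HmT'; unfold T'; tauto).
  unfold satS, sigma2 in H2; cbn [sat] in H2; rewrite sat_exs in H2 by now apply incl_app.
  apply H2; exists a'; split; auto; apply Htrans; auto.
  apply (sat_same_interp Lp M f r f2 r2); auto.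
  rewrite (categorical_automorphism L Lp M T p f r g) in Ha by auto.
  revert Ha; apply sat_coinc; intros x Hx; symmetry; apply Hgaa.
  apply Hv, in_seq in Hx; lia.
Qed.

Lemma type_determined n a b :
  0 < n -> same_type L M N n a b -> same_type Lp (expand M f r) N n a b.
Proof.
  intros Hn Hab; apply same_type_half; intros phi Hw Hv Ha.
  destruct (classic (exists isf i k0, ar isf L i = None /\ ar isf Lp i = Some k0))
    as [(isf & i & k0 & HLi & HLpi)|Hold].
  - destruct (classic (exists d1 d2 : dom M, d1 <> d2)) as [(d1 & d2 & Hd)|Hone].
    + now apply (determined_coded isf i k0 n a b phi d1 d2).
    + apply determined_singleton with n a; auto.
      intros d e; apply NNPP; intros Hd; apply Hone; eauto.
  (* Every symbol of [Lp] is already in [L] with the same arity, so [phi] is an [L]-formula. *)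
  - assert (HLpL : lang_ext Lp L).
    { destruct Hext as [_ [Hf Hr]]; split; intros j m Hj.
      - destruct (fun_ar L j) as [m'|] eqn:E; [now rewrite <- Hj; symmetry; apply Hf|].
        exfalso; apply Hold; now exists true, j, m.
      - destruct (rel_ar L j) as [m'|] eqn:E; [now rewrite <- Hj; symmetry; apply Hr|].
        exfalso; apply Hold; now exists false, j, m. }
    apply (wf_form_mono Lp L) in Hw; auto.
    apply Hab; auto; now apply (sat_expansion L M f r).
Qed.

(** An [L]-elementary map takes each tuple to one of the same [L]-type, so [type_determined]
    applies. *)
Lemma elementary_lift g :
  elem_embedding L M N g -> elem_embedding Lp (expand M f r) N g.
Proof.
  intros Hg phi s Hw; destruct (seq_bound (fv phi)) as (n & Hn & Hv).
  apply (type_determined n); auto; intros psi Hwp _; now apply Hg.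
Qed.

End Determined.

(** * Embedding the expansion into every saturated model *)

Lemma elem_embedding_equiv Lp A B g : elem_embedding Lp A B g -> elem_equiv Lp A B.
Proof.
  intros Hg phi [Hw Hv]; unfold satS; rewrite (Hg phi _ Hw); now apply sat_sentence.
Qed.

Theorem mainTheorem9 :
  forall (L : lang) (M : str) (X : (nat -> Prop) -> Prop),
    recursive_lang L -> countable_str M ->
    scott_set X -> transcendent_wit L M X ->
  forall (Lp : lang) (T p : form -> Prop),
    recursive_ext L Lp ->
    theory Lp T -> X (codeset T) ->
    is_type Lp p -> X (codeset p) ->
    categorical_over L Lp M T p ->
    con_sat L M T p ->
  forall N : str,
    models_Th L M N -> models N T -> omits N p -> omega_sat L N ->
    (exists f r,
       is_expansion L M f r /\ models (expand M f r) T /\ omits (expand M f r) p /\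
       (forall f' r', is_expansion L M f' r' -> models (expand M f' r') T ->
          omits (expand M f' r') p -> same_interp Lp f f' r r') /\
       exists g : dom M -> dom N, elem_embedding Lp (expand M f r) N g) /\
    (forall N' : str,
       models_Th L M N' -> models N' T -> omits N' p -> omega_sat L N' ->
       elem_equiv Lp N N').
Proof.
  intros L M X _ Hcount HX Htr Lp T p Hext HT XT Hp Xp Hcat Hcon N HN HNT HNp HNsat.
  pose proof Htr as (_ & _ & Hplus).
  destruct (Hplus Lp T p Hext HT XT Hp Xp Hcon) as (f & r & Hexp & HMT & HMp).
  (* Stated for every [N'] with one fixed expansion of [M], through which any two such models are
     then compared. *)
  assert (Hemb : forall N', models_Th L M N' -> models N' T -> omits N' p ->
    omega_sat L N' -> exists g, elem_embedding Lp (expand M f r) N' g).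
  { intros N' H1 H2 H3 H4; destruct (countable_embedding L M N' Hcount H1 H4) as [g Hg].
    exists g; now apply elementary_lift with L X T p. }
  split.
  - exists f, r; repeat (split; [now auto|]); auto.
  - intros N' H1 H2 H3 H4 phi Hphi.
    destruct (Hemb N) as [g Hg]; auto; destruct (Hemb N') as [g' Hg']; auto.
    now rewrite <- (elem_embedding_equiv _ _ _ _ Hg phi Hphi),
      <- (elem_embedding_equiv _ _ _ _ Hg' phi Hphi).
Qed.
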